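(* Let $d$ be a positive integer and let $X\subseteq\mathbb{N}^d$ be a finite set with $|X|\geq 3$. For infinitely many $n\in\mathbb{N}$, the number of $X$-free subsets of $[n]^d$ is $2^{O(r_X(n))}$; that is, there exist a constant $C>0$ depending only on $d$ and $X$ and an infinite set $N\subseteq\mathbb{N}$ such that, for every $n\in N$, the number of $X$-free subsets of $[n]^d$ is at most $2^{C\cdot r_X(n)}$.
   Context: Write $[n]=\{1,\dots,n\}$. For $X\subseteq\mathbb{N}^d$, a copy of $X$ is a set of the form $\boldsymbol{b}+rX=\{\boldsymbol{b}+r\boldsymbol{x}:\boldsymbol{x}\in X\}$ with $\boldsymbol{b}\in\mathbb{R}^d$ and $r\in\mathbb{R}_{\geq 0}$; it is non-trivial if $r\neq 0$. A set $A\subseteq[n]^d$ is $X$-free if it contains no non-trivial copy of $X$ as a subset. $r_X(n)$ denotes the maximum cardinality of an $X$-free subset of $[n]^d$. *)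

(* Defs.v *)
From HB Require Import structures.
From mathcomp Require Import all_boot all_order all_algebra.
From mathcomp Require Import finmap.
From mathcomp Require Import boolp classical_sets reals.

Set Implicit Arguments.
Unset Strict Implicit.
Unset Printing Implicit Defensive.

Import Order.TTheory GRing.Theory Num.Theory.

Local Open Scope classical_set_scope.
Local Open Scope ring_scope.

Definition real_vec (R : realType) (d : nat) (x : 'rV[nat]_d) : 'rV[R]_d :=
  map_mx (fun k : nat => k%:R) x.

Definition copy (R : realType) (d : nat) (X : {fset 'rV[nat]_d})
    (b : 'rV[R]_d) (r : R) : set 'rV[R]_d :=
  [set b + r *: real_vec R x | x in [set` X]].

Definition is_free (R : realType) (d : nat) (X : {fset 'rV[nat]_d})
    (A : set 'rV[nat]_d) : Prop :=
  forall (b : 'rV[R]_d) (r : R), 0 <= r -> r != 0 ->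
    ~ (copy X b r `<=` @real_vec R d @` A).

(* [n] = {1, ..., n}, whereas 'I_n is {0, ..., n-1}: subsets of [n]^d are
   encoded as {set 'rV['I_n]_d}, the row p standing for the point with
   coordinates (p 0 j).+1. *)
Definition grid_point (n d : nat) (p : 'rV['I_n]_d) : 'rV[nat]_d :=
  map_mx (fun i : 'I_n => i.+1) p.

Definition free_sets (R : realType) (d : nat) (X : {fset 'rV[nat]_d})
    (n : nat) : {set {set 'rV['I_n]_d}} :=
  [set A : {set 'rV['I_n]_d} |
    `[< is_free R X (@grid_point n d @` [set` A]) >]]%SET.

(* The junk value 0 of an empty maximum does not occur for nonempty X, since
   the empty set is then X-free. *)
Definition max_free (R : realType) (d : nat) (X : {fset 'rV[nat]_d})
    (n : nat) : nat :=
  (\max_(A in free_sets R X n) #|A|)%N.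

(* Main.v *)
(* Two facts about copies of X are combined. Two vertices lie in boundedly many
   copies, so a hypergraph container argument applies with all losses polynomial
   in y = 2^m, where n = 2^(m^2). Supersaturation: if the density of the largest
   X-free sets at scale n is within a constant factor of that at scale
   n / 2^(2am - a^2) = 2^((m-a)^2), then every set of size a large multiple of
   r_X(n) meets many dilated boxes q [2^((m-a)^2)]^d, q prime, in more points
   than an X-free set can have, hence spans at least y^delta copies per vertex,
   for any prescribed delta once a is large; q is prime so that each copy is
   counted at most log n times for each position of the box. Behrend's
   construction gives r_X(n) >= n^d y^(-C), and this is exactly what forbids the
   density to drop by more than a constant factor from m - a to m for all large
   m, so the good scales are infinitely many. *)

Require Import Defs.
From HB Require Import structures.
From mathcomp Require Import all_boot all_order all_algebra.
From mathcomp Require Import finmap.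
From mathcomp Require Import boolp classical_sets cardinality reals exp.
From mathcomp Require Import zify ring lra.

Set Implicit Arguments.
Unset Strict Implicit.
Unset Printing Implicit Defensive.

Import Order.TTheory GRing.Theory Num.Theory.

Local Open Scope ring_scope.

(** * Decision trees and containers *)

Section Containers.
Local Open Scope nat_scope.
Variables (V : finType) (fam : pred {set V}).
Implicit Types (I J Z W : {set V}) (F L : {set {set V}}) (Q : {set V} -> {set V} -> Prop).

(* [J] collects the vertices known to lie in the unknown member [I] of [fam],
   [Z] the vertices known to lie outside it. *)
Inductive dtree Q : {set V} -> {set V} -> Prop :=
| DLeaf J Z of Q J Z : dtree Q J Z
| DQuery J Z v of v \notin J & v \notin Z &
    dtree Q (v |: J) Z & dtree Q J (v |: Z) : dtree Q J Z
| DExclude J Z W of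
    (forall I, fam I -> J \subset I -> [disjoint I & Z] -> [disjoint I & W]) &
    dtree Q J (Z :|: W) : dtree Q J Z.

Definition consistent J Z : {set {set V}} :=
  [set I | [&& fam I, J \subset I & [disjoint I & Z]]]%SET.

Lemma dtree_leaf_ge Q J Z s c :
  (forall (J' Z' : {set V}), Q J' Z' -> #|J'| <= s /\ #|~: Z'| <= c) ->
  dtree Q J Z -> #|J| <= s.
Proof.
move=> hQ; elim=> {J Z} [J Z /hQ[]//|J Z v vJ _ _ IH _ _|//].
by apply: leq_trans IH; rewrite subset_leq_card ?finset.subsetUr.
Qed.

(** Each leaf accounts for at most [2 ^ c] members. A query uses up one undetermined vertex: the
    answer [no] lowers the base of the power by one, the answer [yes] lowers the exponent as well,
    and [u ^ i + u ^ i.+1 <= u.+1 ^ i.+1] closes the induction. *)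
Lemma dtree_count Q J Z s c :
  (forall (J' Z' : {set V}), Q J' Z' -> #|J'| <= s /\ #|~: Z'| <= c) ->
  dtree Q J Z ->
  #|consistent J Z| <= (#|~: (J :|: Z)|).+1 ^ (s - #|J|) * 2 ^ c.
Proof.
move=> hQ; elim=> {J Z} [J Z|J Z v vJ vZ t1 IH1 t2 IH2|J Z W hW t IH].
- case/hQ=> _ hc; apply: (@leq_trans (2 ^ c)); last first.
    by rewrite leq_pmull // expn_gt0.
  apply: (@leq_trans #|powerset (~: Z)|).
    apply/subset_leq_card/fintype.subsetP => I; rewrite !inE => /and3P[_ _].
    by rewrite finset.disjoints_subset.
  by rewrite card_powerset leq_exp2l.
- have hs := dtree_leaf_ge hQ t1.
  set u := #|~: (J :|: Z)|.
  have hu : v \in ~: (J :|: Z) by rewrite !inE negb_or vJ.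
  have u1 : #|~: ((v |: J) :|: Z)| = u.-1.
    rewrite /u (cardsD1 v (~: (J :|: Z))) hu /=; apply: eq_card => x.
    by rewrite !inE -orbA negb_or.
  have u2 : #|~: (J :|: (v |: Z))| = u.-1.
    rewrite /u (cardsD1 v (~: (J :|: Z))) hu /=; apply: eq_card => x.
    by rewrite !inE orbCA negb_or.
  have u0 : 0 < u by rewrite /u (cardsD1 v (~: (J :|: Z))) hu.
  have hsub : consistent J Z \subset
      consistent (v |: J) Z :|: consistent J (v |: Z).
    apply/fintype.subsetP => I; rewrite !inE => /and3P[-> hJ hZ] /=.
    rewrite finset.subUset hJ hZ finset.sub1set /= !andbT.
    case: (boolP (v \in I)) => //= vI.
    rewrite disjoint_sym finset.disjoints_subset finset.subUset finset.sub1set.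
    by rewrite inE vI -finset.disjoints_subset disjoint_sym.
  apply: leq_trans (subset_leq_card hsub) _.
  apply: leq_trans (leq_card_setU _ _) _.
  apply: leq_trans (leq_add IH1 IH2) _.
  rewrite u1 u2 prednK // cardsU1 vJ -mulnDl leq_mul2r orbC.
  rewrite cardsU1 vJ in hs.
  have -> : s - #|J| = (s - (true + #|J|)).+1 by lia.
  move: (s - (true + #|J|)) => i.
  have hi : u ^ i <= u.+1 ^ i by case: i => // i; rewrite leq_exp2r.
  by rewrite !expnS mulSn leq_add // leq_mul.
- apply: leq_trans.
    apply: (@leq_trans #|consistent J (Z :|: W)|); last exact: IH.
    apply/subset_leq_card/fintype.subsetP => I; rewrite !inE => /and3P[fI hJ hZ].
    rewrite fI hJ /= disjoint_sym finset.disjoints_subset finset.subUset.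
    by rewrite -!finset.disjoints_subset !(disjoint_sym _ I) hZ hW.
  rewrite leq_mul2r; apply/orP; right.
  have hl : #|~: (J :|: (Z :|: W))| <= #|~: (J :|: Z)|.
    by rewrite subset_leq_card // finset.setCS finset.setUA finset.subsetUl.
  by case: (s - #|J|) => [//|i]; rewrite leq_exp2r.
Qed.

Lemma dtree_bind Q Q' J Z :
  (forall (J' Z' : {set V}), Q J' Z' -> dtree Q' J' Z') -> dtree Q J Z -> dtree Q' J Z.
Proof.
move=> hQ; elim=> {J Z} [J Z /hQ//|J Z v vJ vZ _ t1 _ t2|J Z W hW _ t].
  exact: DQuery t1 t2.
exact: DExclude t.
Qed.

Definition deg F (u : V) := #|[set e in F | u \in e]%SET|.

Lemma sum_deg F W : \sum_(u in W) deg F u = \sum_(e in F) #|e :&: W|.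
Proof.
transitivity (\sum_(u in W) \sum_(e in F) (u \in e : nat)).
  apply: eq_bigr => u _; rewrite /deg -sum1_card [RHS]big_mkcond [LHS]big_mkcond.
  by apply: eq_bigr => e _; rewrite !inE; case: (e \in F).
rewrite exchange_big /=; apply: eq_bigr => e _.
rewrite -sum1_card big_mkcond [RHS]big_mkcond; apply: eq_bigr => u _.
by rewrite inE; case: (u \in W); case: (u \in e).
Qed.

Lemma card_hit_le F W :
  #|[set e in F | ~~ [disjoint e & W]]%SET| <= \sum_(u in W) deg F u.
Proof.
rewrite sum_deg -sum1_card big_mkcond [leqRHS]big_mkcond; apply: leq_sum => e _.
rewrite !inE; case: (e \in F) => //=.
by rewrite -finset.setI_eq0 -card_gt0; case: #|_|.
Qed.

(** Averaging: every edge of [L] has a vertex outside [J], so the degrees outside [J] sum to at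
    least [#|L|]. *)
Lemma exists_high_degree L J :
  (0 < #|L|) -> (forall e, e \in L -> ~~ (e \subset J)) ->
  exists2 v, v \notin J & 0 < deg L v /\ #|L| <= #|V| * deg L v.
Proof.
move=> L0 hL.
have hs : #|L| <= \sum_(u in ~: J) deg L u.
  apply: leq_trans (card_hit_le _ _).
  apply/subset_leq_card/fintype.subsetP => e eL; rewrite inE eL /=.
  by rewrite finset.disjoints_subset finset.setCK hL.
have [e0 e0L] : exists e, e \in L by apply/card_gt0P.
have /subsetPn[v0 _ v0J] := hL _ e0L.
case: (arg_maxnP (deg L) (P := fun v => v \notin J) (i0 := v0) v0J) => v vJ vmax.
have hv : #|L| <= #|V| * deg L v.
  apply: leq_trans hs _; rewrite -sum_nat_const.
  rewrite [leqRHS](bigID (mem (~: J))) /= -[leqLHS]addn0 leq_add //.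
  by apply: leq_sum => u; rewrite inE; apply: vmax.
by exists v => //; split=> //; move: hv; case: (deg L v) => //; lia.
Qed.

(** When no member fits the state, every vertex may be excluded, so the branch can be closed with an
    empty container. *)
Lemma dtree_dead Q J Z :
  (forall I, fam I -> J \subset I -> [disjoint I & Z] -> False) ->
  dtree Q J [set: V]%SET -> dtree Q J Z.
Proof.
move=> h t; apply: (@DExclude _ _ _ [set: V]%SET); last by rewrite finset.setUT.
by move=> I fI JI IZ; case: (h I).
Qed.

(* Kleitman-Winston step: the edges through the vertices queried with answer
   "yes" are collected in [F']; a vertex contained in [Delta] collected edges
   is saturated, and only edges that avoid the saturated vertices count as
   live when the next vertex of high degree is chosen. *)
Lemma container_level Q F J (Zb : {set V}) s rho D Delta k lam j :
  (forall e I, e \in F -> fam I -> ~~ (e \subset I)) ->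
  (forall e, e \in F -> #|e| <= k) ->
  (forall u v, u != v -> #|[set e in F | (u \in e) && (v \in e)]%SET| <= lam) ->
  (forall e, e \in F -> [disjoint e & Zb]) ->
  (forall u, u \notin J -> deg F u <= D) ->
  (forall e, e \in F -> #|e :\: J| <= j.+1) ->
  0 < #|F| -> 0 < Delta ->
  6 * rho * D <= #|F| -> 6 * s * D <= #|F| ->
  6 * k * s * D * D <= #|F| * Delta ->
  #|Zb| + rho <= #|V| ->
  (forall (J' Z' : {set V}), #|J'| <= #|J| + s -> Zb \subset Z' -> #|Zb| + rho <= #|Z'| ->
     dtree Q J' Z') ->
  (forall (J' Z' : {set V}) (F' : {set {set V}}), #|J'| = #|J| + s -> Zb \subset Z' -> F' \subset F ->
     [disjoint J' & Z'] ->
     (forall e, e \in F' -> #|e :\: J'| <= j) ->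
     (forall u, u \notin J' -> deg F' u <= Delta + lam) ->
     s * #|F| <= 2 * #|V| * #|F'| -> dtree Q J' Z') ->
  forall Z, Zb \subset Z -> [disjoint J & Z] -> dtree Q J Z.
Proof.
move=> Find Fk Flam FZb FD Fj F0 Delta0 hrho hs hsat ZbV Qgain Qnext.
have dead (J' Z' : {set V}) : #|J'| <= #|J| + s ->
    (exists2 e, e \in F & e \subset J') -> dtree Q J' Z'.
  move=> J's [e eF eJ]; apply: dtree_dead.
    by move=> I fI JI _; move: (Find e I eF fI); rewrite (fintype.subset_trans eJ JI).
  by apply: Qgain => //; rewrite ?finset.subsetT // cardsT.
(* Induction on [#|~: Z'| + #|~: J'|], which drops at each query. [F'] holds the edges collected
   through the accepted vertices [J' :\: J]; the last hypothesis says that an accepted vertex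
   brought at least [#|F| / (2 * #|V|)] new edges on average. *)
suff main m (J' Z' : {set V}) (F' : {set {set V}}) : #|~: Z'| + #|~: J'| < m ->
    J \subset J' -> #|J'| <= #|J| + s -> Zb \subset Z' -> [disjoint J' & Z'] ->
    F' \subset F -> (forall e, e \in F' -> ~~ [disjoint e & J' :\: J]) ->
    (forall u, u \notin J' -> deg F' u <= Delta + lam) ->
    #|J' :\: J| * #|F| <= 2 * #|V| * #|F'| -> dtree Q J' Z'.
  move=> Z ZbZ JZ; apply: (main _ J Z finset.set0 (ltnSn _)) => //.
  - by rewrite leq_addr.
  - by rewrite finset.sub0set.
  - by move=> e; rewrite inE.
  - by move=> u _; rewrite /deg eq_card0 // => e; rewrite !inE.
  - by rewrite finset.setDv cards0.
elim: m J' Z' F' => // m IH J' Z' F' hm JJ' J's ZbZ' J'Z' F'F F'hit F'deg F'card.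
have cardJ' : #|J'| = #|J| + #|J' :\: J|.
  by rewrite cardsDS // subnKC // subset_leq_card.
(* After [s] answers [yes] the level ends: every collected edge meets [J' :\: J], so fewer of its
   vertices remain outside. *)
have [J'eq|J'ne] := eqVneq #|J'| (#|J| + s).
  apply: (Qnext J' Z' F') => //.
    move=> e eF'; have eF := fintype.subsetP F'F e eF'.
    rewrite -ltnS; apply: leq_trans (Fj e eF); apply: proper_card.
    apply/fintype.properP; split.
      apply/fintype.subsetP => x; rewrite !inE => /andP[h ->].
      by rewrite (contra _ h) //; apply/fintype.subsetP.
    have /pred0Pn[x] := F'hit e eF'; rewrite /= !inE => /and3P[xe xJ xJ'].
    by exists x; rewrite !inE ?xJ ?xe ?xJ'.
  by move: F'card; rewrite (_ : #|J' :\: J| = s) //; lia.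
have J's' : #|J' :\: J| < s by lia.
have [hgain|hngain] := leqP (#|Zb| + rho) #|Z'|; first exact: Qgain.
have [/existsP[e /andP[eF eJ]]|] := boolP [exists e in F, e \subset J].
  by apply: dead => //; exists e => //; apply: fintype.subset_trans JJ'.
rewrite negb_exists => /forallP Fout.
set Sat := [set u | (u \notin J') && (Delta <= deg F' u)]%SET.
set W := (Z' :\: Zb) :|: (J' :\: J) :|: Sat.
set L := [set e in F | [disjoint e & W]]%SET.
have WJ u : u \in W -> u \notin J.
  rewrite !inE -orbA => /or3P[/andP[_ uZ']|/andP[]//|/andP[uJ' _]].
    apply/negP => /(fintype.subsetP JJ') uJ'.
    by move: J'Z' => /pred0P/(_ u)/=; rewrite uJ' uZ'.
  by apply: contra uJ'; apply/fintype.subsetP.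
have degW (U : {set V}) : U \subset W -> \sum_(u in U) deg F u <= #|U| * D.
  move=> UW; rewrite -sum_nat_const; apply: leq_sum => u uU.
  by apply/FD/WJ/(fintype.subsetP UW).
have F'le : #|F'| <= s * D.
  apply: (@leq_trans (#|J' :\: J| * D)); last by rewrite leq_mul2r ltnW ?orbT.
  apply: leq_trans (degW (J' :\: J) _); last first.
    by apply/fintype.subsetP => u; rewrite !inE => ->; rewrite orbT.
  apply: leq_trans (card_hit_le _ _).
  apply/subset_leq_card/fintype.subsetP => e eF'; rewrite inE F'hit // andbT.
  exact: (fintype.subsetP F'F).
have Satle : #|Sat| * Delta <= k * s * D.
  apply: (@leq_trans (\sum_(u in Sat) deg F' u)).
    by rewrite -sum_nat_const; apply: leq_sum => u; rewrite inE => /andP[].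
  rewrite sum_deg; apply: (@leq_trans (\sum_(e in F') k)).
    apply: leq_sum => e /(fintype.subsetP F'F) /Fk; apply: leq_trans.
    by rewrite subset_leq_card // finset.subsetIl.
  by rewrite sum_nat_const mulnC -mulnA leq_mul2l F'le orbT.
(* The newly excluded, the accepted and the saturated vertices each meet at most a sixth of [F], so
   at least half of the edges are live. *)
have Lcard : #|F| <= 2 * #|L|.
  have hFL : #|F| <= #|L| + #|W| * D.
    have hit := leq_trans (card_hit_le F W) (degW W (subxx_hint (mem W))).
    apply: leq_trans (leq_add (leqnn _) hit).
    rewrite -(cardsID [set e : {set V} | [disjoint e & W]]%SET F) leq_add //.
      by apply/subset_leq_card/fintype.subsetP => e; rewrite !inE.
    by apply/subset_leq_card/fintype.subsetP => e; rewrite !inE andbC.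
  have hW : #|W| <= rho + s + #|Sat|.
    apply: leq_trans (leq_card_setU _ _) _; rewrite leq_add2r.
    apply: leq_trans (leq_card_setU _ _) _; rewrite leq_add // ?(ltnW J's') //.
    by rewrite cardsDS // leq_subLR ltnW.
  have hSat : 6 * (#|Sat| * D) <= #|F|.
    rewrite -(leq_pmul2r Delta0); apply: leq_trans hsat.
    have -> : 6 * (#|Sat| * D) * Delta = 6 * (#|Sat| * Delta) * D by lia.
    by have := leq_mul (leq_mul (leqnn 6) Satle) (leqnn D); rewrite !mulnA.
  have : #|W| * D <= (rho + s + #|Sat|) * D by rewrite leq_mul2r hW orbT.
  lia.
have L0 : 0 < #|L| by lia.
have LF : L \subset F by apply/fintype.subsetP => e; rewrite inE => /andP[].
have LW e u : e \in L -> u \in e -> u \notin W.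
  rewrite inE => /andP[_ /pred0P h] ue; apply/negP => uW.
  by move: (h u); rewrite /= ue uW.
have [e /(fintype.subsetP LF) eF|v vJ [degv0 hv]] := @exists_high_degree L J L0.
  by have := Fout e; rewrite eF.
have [e0] : exists e, e \in [set e in L | v \in e]%SET by apply/card_gt0P.
rewrite inE => /andP[e0L ve0].
have := LW _ _ e0L ve0; rewrite !inE !negb_or => /andP[/andP[vZ' vJ'] vSat].
have {vJ'}vJ' : v \notin J' by move: vJ'; rewrite vJ.
have {vZ'}vZ' : v \notin Z'.
  move: vZ'; rewrite negb_and negbK => /orP[vZb|//].
  have := FZb e0 (fintype.subsetP LF _ e0L).
  by move=> /pred0P/(_ v)/=; rewrite ve0 vZb.
apply: (@DQuery _ _ _ v) => //.
  apply: (IH _ _ (F' :|: [set e in L | v \in e]%SET)).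
  - rewrite -ltnS; apply: leq_trans hm; rewrite ltnS ltn_add2l; apply: proper_card.
    rewrite finset.properC; apply/fintype.properP; split; first exact: finset.subsetUr.
    by exists v => //; rewrite !inE eqxx.
  - exact: fintype.subset_trans JJ' (finset.subsetUr _ _).
  - by rewrite cardsU1 vJ'; lia.
  - by [].
  - rewrite finset.disjoints_subset finset.subUset finset.sub1set inE vZ'.
    by rewrite -finset.disjoints_subset.
  - rewrite finset.subUset F'F; apply: fintype.subset_trans LF.
    by apply/fintype.subsetP => e; rewrite inE => /andP[].
  - move=> e; rewrite !inE => /orP[eF'|/andP[_ ve]]; apply/pred0Pn.
      have /pred0Pn[x] := F'hit e eF'; rewrite /= !inE => /and3P[xe xJ xJ'].
      by exists x; rewrite /= !inE xe xJ xJ' orbT.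
    by exists v; rewrite /= !inE ve eqxx vJ.
  - move=> u; rewrite !inE negb_or => /andP[uv uJ'].
    have hU : deg (F' :|: [set e in L | v \in e]%SET) u <=
        deg F' u + #|[set e in L | (v \in e) && (u \in e)]%SET|.
      apply: leq_trans (leq_card_setU _ _).
      apply/subset_leq_card/fintype.subsetP => e; rewrite !inE.
      by case: (e \in F'); case: (u \in e); rewrite ?andbT ?andbF ?orbF.
    apply: leq_trans hU _.
    (* A vertex that gains an edge lies on a live edge, hence was not saturated before; the codegree
       bound limits its gain to [lam]. *)
    case: (set_0Vmem [set e in L | (v \in e) && (u \in e)]%SET) => [->|[e1]].
      by rewrite cards0 addn0 F'deg.
    rewrite inE => /and3P[e1L _ ue1]; apply: leq_add.
      have := LW _ _ e1L ue1; rewrite !inE !negb_or uJ' /= => /andP[_].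
      by rewrite -ltnNge => /ltnW.
    apply: leq_trans (Flam v u _); last by rewrite eq_sym.
    apply/subset_leq_card/fintype.subsetP => e; rewrite inE => /andP[eL h].
    by rewrite inE h (fintype.subsetP LF).
  - have -> : (v |: J') :\: J = v |: (J' :\: J).
      by apply/setP => x; rewrite !inE; case: eqVneq => [->|]//=; rewrite vJ.
    rewrite cardsU1 !inE (negPf vJ') andbF /= mulnDl mul1n.
    have dF' : F' :&: [set e in L | v \in e]%SET = finset.set0.
      apply/eqP; rewrite -finset.subset0; apply/fintype.subsetP => e.
      rewrite finset.in_setI => /andP[eF']; rewrite inE => /andP[eL _].
      have /pred0Pn[x] := F'hit e eF'; rewrite /= !inE => /and3P[xe xJ xJ'].
      by have := LW _ _ eL xe; rewrite !inE xJ xJ' orbT.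
    rewrite cardsU dF' cards0 subn0 mulnDr addnC leq_add //.
    by apply: leq_trans Lcard _; rewrite -mulnA leq_mul2l hv.
apply: (IH _ _ F') => //.
- rewrite -ltnS; apply: leq_trans hm; rewrite ltnS ltn_add2r; apply: proper_card.
  rewrite finset.properC; apply/fintype.properP; split; first exact: finset.subsetUr.
  by exists v => //; rewrite !inE eqxx.
- exact: fintype.subset_trans ZbZ' (finset.subsetUr _ _).
- rewrite disjoint_sym finset.disjoints_subset finset.subUset finset.sub1set inE vJ'.
  by rewrite -finset.disjoints_subset disjoint_sym.
Qed.

Lemma leq_iter_affine i p : p <= iter i (fun p => 2 * p + 3) p.
Proof. by elim: i => //= i; lia. Qed.

(** Induction on [j]; at [j = 0] an edge lies inside [J], so no member fits. The number of edges per
    vertex is within a factor [y ^ p] of the degree bound [y ^ delta]; one level turns [p] into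
    [2 * p + 3] and [delta] into [2 + p + delta - q]. Keeping the iterates of [p] below [w] makes
    the vertices counted by [rho] and [s] negligible at every level. *)
Lemma container_levels Q s rho k lam y q w :
  6 <= y -> 6 * k <= y -> lam < y -> w <= q -> 0 < s -> 0 < rho ->
  #|V| = s * y ^ q -> #|V| = rho * y ^ w ->
  forall j p delta F J (Zb : {set V}),
  iter j (fun p => 2 * p + 3) p < w -> j * q <= delta ->
  (forall e I, e \in F -> fam I -> ~~ (e \subset I)) ->
  (forall e, e \in F -> #|e| <= k) ->
  (forall u v, u != v -> #|[set e in F | (u \in e) && (v \in e)]%SET| <= lam) ->
  (forall e, e \in F -> [disjoint e & Zb]) ->
  (forall u, u \notin J -> deg F u <= y ^ delta) ->
  (forall e, e \in F -> #|e :\: J| <= j) ->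
  #|V| * y ^ delta <= #|F| * y ^ p ->
  #|Zb| + rho <= #|V| ->
  (forall (J' Z' : {set V}), #|J'| <= #|J| + j * s -> #|Zb| + rho <= #|Z'| ->
     dtree Q J' Z') ->
  forall Z, Zb \subset Z -> [disjoint J & Z] -> dtree Q J Z.
Proof.
move=> y6 ky lamy wq s0 rho0 Vs Vrho.
have y0 : 0 < y by lia.
have yX i : 0 < y ^ i by rewrite expn_gt0 y0.
elim=> [|j IH] p delta F J Zb hw hq Find Fk Flam FZb FD Fj Fcard ZbV Qgain Z ZbZ JZ.
  have F0 : 0 < #|F|.
    by have := leq_trans (_ : 0 < _) Fcard; rewrite !muln_gt0 Vs !muln_gt0 s0 !yX => /(_ isT)/andP[].
  have [e eF] : exists e, e \in F by apply/card_gt0P.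
  apply: dtree_dead; last by apply: Qgain; rewrite ?leq_addr // cardsT.
  move=> I fI JI _; have := Fj e eF; rewrite leqn0 cards_eq0 finset.setD_eq0 => eJ.
  by have := Find e I eF fI; rewrite (fintype.subset_trans eJ JI).
rewrite iterSr in hw.
have pw : p + 1 < w by have := leq_iter_affine j (2 * p + 3); lia.
have F0 : 0 < #|F|.
  by have := leq_trans (_ : 0 < _) Fcard; rewrite !muln_gt0 Vs !muln_gt0 s0 !yX => /(_ isT)/andP[].
have small t i : #|V| = t * y ^ i -> w <= i -> 6 * t * y ^ delta <= #|F|.
  move=> Vt wi; rewrite -(leq_pmul2r (yX p)); apply: leq_trans Fcard.
  rewrite Vt; have -> : y ^ i = y ^ (i - p.+1) * y ^ p * y.
    by rewrite -expnD -expnSr; congr (_ ^ _); lia.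
  rewrite -!mulnA mulnCA leq_mul2l; apply/orP; right.
  rewrite [X in _ <= X](_ : _ = (y ^ (i - p.+1) * y) * (y ^ delta * y ^ p)); last by lia.
  by rewrite leq_mul2r; apply/orP; right; rewrite (leq_trans y6) // leq_pmull.
(* The threshold is tuned to [Delta * y ^ q = y ^ delta * y ^ p * y]: the spare factor [y] covers
   the constant [6 * k] in the saturation condition. *)
set Delta := y ^ (1 + p + delta - q).
have hqd : q <= delta by rewrite (leq_trans _ hq) // leq_pmull.
have DeltaE : Delta * y ^ q = y ^ delta * y ^ p * y.
  by rewrite /Delta -!expnD -expnSr; congr (_ ^ _); lia.
apply: (@container_level Q F J Zb s rho (y ^ delta) Delta k lam j) => //.
- exact: yX.
- exact: (small _ w).
- exact: (small _ q).
- rewrite -(leq_pmul2r (yX p)).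
  have := leq_mul Fcard (leqnn Delta).
  rewrite Vs => h.
  rewrite [X in _ <= X](_ : _ = #|F| * y ^ p * Delta); last by lia.
  apply: leq_trans h.
  rewrite [X in _ <= X](_ : _ = s * y ^ delta * (Delta * y ^ q)); last by lia.
  rewrite DeltaE.
  rewrite [X in X <= _](_ : _ = (s * y ^ delta * y ^ delta * y ^ p) * (6 * k)); last by lia.
  rewrite [X in _ <= X](_ : _ = (s * y ^ delta * y ^ delta * y ^ p) * y); last by lia.
  by rewrite leq_mul2l ky orbT.
- move=> J' Z' J's _ hZ'; apply: Qgain => //.
  by apply: leq_trans J's _; rewrite mulSn; lia.
move=> J' Z' F' J's ZbZ' F'F J'Z' F'j F'deg F'card.
apply: (IH (2 * p + 3) (2 + p + delta - q) F' J' Zb) => //.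
- by rewrite mulSn in hq; lia.
- by move=> e I /(fintype.subsetP F'F); apply: Find.
- by move=> e /(fintype.subsetP F'F); apply: Fk.
- move=> u v uv; apply: leq_trans (Flam u v uv).
  apply/subset_leq_card/fintype.subsetP => e; rewrite !inE => /andP[eF' ->].
  by rewrite (fintype.subsetP F'F).
- by move=> e /(fintype.subsetP F'F); apply: FZb.
- move=> u uJ'; apply: leq_trans (F'deg u uJ') _.
  have -> : 2 + p + delta - q = (1 + p + delta - q).+1 by lia.
  rewrite expnS -/Delta; have : 0 < Delta by apply: yX.
  by nia.
- have V0 : 0 < #|V| by rewrite Vs muln_gt0 s0 yX.
  have h1 : s * y ^ delta <= 2 * #|F'| * y ^ p.
    rewrite -(leq_pmul2l V0).
    have := leq_mul (leqnn s) Fcard; have := leq_mul F'card (leqnn (y ^ p)); lia.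
  rewrite -(leq_pmul2r (yX q)).
  have -> : y ^ (2 + p + delta - q) = Delta * y.
    by rewrite /Delta -expnSr; congr (_ ^ _); lia.
  rewrite [X in X <= _](_ : _ = #|V| * y * (Delta * y ^ q)); last by lia.
  rewrite DeltaE Vs.
  rewrite [X in X <= _](_ : _ = (s * y ^ delta) * (y ^ q * y ^ p * y * y)); last by lia.
  apply: leq_trans (leq_mul h1 (leqnn _)) _.
  rewrite (_ : 2 * p + 3 = p + p + 3) ?expnD; last by lia.
  rewrite [X in X <= _](_ : _ = (#|F'| * y ^ p * y ^ p * y ^ q * y * y) * 2); last by lia.
  rewrite [X in _ <= X](_ : _ = (#|F'| * y ^ p * y ^ p * y ^ q * y * y) * y); last first.
    by rewrite (_ : y ^ 3 = y * y * y); [lia | rewrite !expnS expn0 muln1 mulnA].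
  by rewrite leq_mul2l; apply/orP; right; lia.
- move=> J'' Z'' h; apply: Qgain; apply: leq_trans h _.
  by rewrite J's mulSn addnA.
Qed.

(** While the container is too large, the hypothesis supplies a balanced hypergraph inside it, and a
    pass through its levels excludes [rho] further vertices at the price of at most [k * s] answers
    [yes]. As [#|V| = rho * y ^ w], at most [y ^ w] passes are needed. *)
Theorem container_count s rho k lam y q w p delta c :
  6 <= y -> 6 * k <= y -> lam < y -> w <= q -> 0 < s -> 0 < rho ->
  #|V| = s * y ^ q -> #|V| = rho * y ^ w ->
  iter k (fun p => 2 * p + 3) p < w -> k * q <= delta -> rho <= c ->
  (forall A : {set V}, c <= #|A| -> exists F,
    [/\ (forall e I, e \in F -> fam I -> ~~ (e \subset I)),
        (forall e, e \in F -> #|e| <= k /\ e \subset A),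
        (forall u v, u != v ->
           #|[set e in F | (u \in e) && (v \in e)]%SET| <= lam),
        (forall u, deg F u <= y ^ delta) &
        #|V| * y ^ delta <= #|F| * y ^ p]) ->
  #|[set I | fam I]%SET| <=
    #|V|.+1 ^ (k * s * y ^ w) * 2 ^ (c + k * s * y ^ w).
Proof.
move=> y6 ky lamy wq s0 rho0 Vs Vrho hw hq rhoc super.
set S := k * s * y ^ w.
pose Q (J Z : {set V}) := #|J| <= S /\ #|~: Z| <= c + S.
have main m J Z : #|~: Z| <= m * rho -> #|J| + m * (k * s) <= S -> dtree Q J Z.
  elim: m J Z => [|m IH] J Z hZ hJ.
    by apply: DLeaf; split; lia.
  have [hc|hc] := leqP #|~: Z| (c + S); first by apply: DLeaf; split; lia.
  have [JZ|JZ] := boolP [disjoint J & Z]; last first.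
    apply: dtree_dead.
      move=> I _ JI IZ; case/negP: JZ; exact: disjointWl IZ.
    by apply: DLeaf; split; rewrite ?finset.setCT ?cards0 //; lia.
  have [|F [Find Fk Flam Fdeg Fcard]] := super (~: Z :\: J).
    by have := cardsD (~: Z) J; have := subset_leq_card (finset.subsetIr (~: Z) J); lia.
  have VZ : #|V| = #|Z| + #|~: Z| by rewrite cardsC.
  apply: (dtree_bind (Q := fun J' Z' => #|J'| <= #|J| + k * s /\ #|Z| + rho <= #|Z'|)).
    move=> J' Z' [h1 h2]; apply: IH.
      by have := cardsC Z'; rewrite -cardsT cardsT mulSn in hZ *; lia.
    by rewrite mulSn in hJ; lia.
  apply: (@container_levels _ s rho k lam y q w _ _ _ _ _ _ _ _ k p delta F J Z) => //.
  - by move=> e /Fk[].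
  - move=> e /Fk[_ /fintype.subsetP eA]; rewrite finset.disjoints_subset.
    by apply/fintype.subsetP => x /eA; rewrite !inE => /andP[].
  - move=> e /Fk[ek _]; apply: leq_trans ek.
    by rewrite subset_leq_card // finset.subsetDl.
  - by lia.
  - by move=> J' Z' h1 h2; apply: DLeaf.
have t : dtree Q finset.set0 finset.set0.
  apply: (main (y ^ w)); first by rewrite finset.setC0 cardsT Vrho mulnC.
  by rewrite cards0 add0n /S mulnC.
have hQ J' Z' : Q J' Z' -> #|J'| <= S /\ #|~: Z'| <= c + S by [].
apply: leq_trans (leq_trans (dtree_count hQ t) _).
  apply/subset_leq_card/fintype.subsetP => I; rewrite !inE => ->.
  by rewrite finset.sub0set disjoint_sym finset.disjoints_subset finset.sub0set.
by rewrite cards0 subn0 finset.setU0 finset.setC0 cardsT.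
Qed.
End Containers.

(** * Passing to a subhypergraph of bounded maximum degree *)

Section Balancing.
Local Open Scope nat_scope.

(** Take [F] largest among the edge sets inside [A] with degrees at most [D]. If [b] vertices are
    saturated, double counting bounds [#|F|] from below; otherwise the unsaturated part of [A] still
    has [b] vertices, and every edge it spans belongs to [F] by maximality. *)
Lemma balanced_subhypergraph (V : finType) (G : {set {set V}}) (A : {set V})
    (k D b : nat) :
  (0 < k)%N -> (forall e, e \in G -> (#|e| <= k)%N) ->
  (forall A' : {set V}, A' \subset A -> (b <= #|A'|)%N ->
     (D * b <= #|[set e in G | e \subset A']%SET|)%N) ->
  (2 * b <= #|A|)%N ->
  exists F : {set {set V}}, [/\ F \subset [set e in G | e \subset A]%SET,
    forall u, (deg F u <= D)%N & (D * b <= k * #|F|)%N].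
Proof.
move=> k0 Gk hG hb.
set GA := [set e in G | e \subset A]%SET.
pose P (F : {set {set V}}) := (F \subset GA) && [forall u, deg F u <= D].
have P0 : P finset.set0.
  rewrite /P finset.sub0set; apply/forallP => u.
  by rewrite /deg eq_card0 // => e; rewrite !inE.
case: (arg_maxnP (fun F : {set {set V}} => #|F|) P0) => F /andP[FG /forallP Fdeg] Fmax.
exists F; split=> //.
set Sat := [set u in A | deg F u == D]%SET.
have [hS|hS] := leqP b #|Sat|.
  apply: (@leq_trans (\sum_(u in Sat) deg F u)).
    rewrite (eq_bigr (fun _ => D)); last by move=> u; rewrite inE => /andP[_ /eqP].
    by rewrite sum_nat_const mulnC leq_mul2r hS orbT.
  rewrite sum_deg mulnC -sum_nat_const; apply: leq_sum => e eF.
  have := fintype.subsetP FG e eF; rewrite inE => /andP[/Gk ek _].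
  by rewrite (leq_trans _ ek) // subset_leq_card // finset.subsetIl.
have hA : b <= #|A :\: Sat|.
  by have := cardsD A Sat; have := subset_leq_card (finset.subsetIr A Sat); lia.
apply: leq_trans (hG _ (finset.subsetDl _ _) hA) _.
rewrite -[leqLHS]mul1n leq_mul // subset_leq_card //.
apply/fintype.subsetP => e; rewrite inE => /andP[eG eAS].
have eA : e \subset A by apply: fintype.subset_trans eAS (finset.subsetDl _ _).
apply: contraT => eF; have : P (e |: F).
  apply/andP; split.
    by rewrite finset.subUset FG finset.sub1set inE eG eA.
  apply/forallP => u; case: (boolP (u \in e)) => ue; last first.
    rewrite /deg (_ : [set _ in _ | _]%SET = [set e in F | u \in e]%SET) ?Fdeg //.
    by apply/setP => f; rewrite !inE; case: eqVneq => // ->; rewrite (negPf ue) !andbF.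
  have := fintype.subsetP eAS u ue; rewrite !inE => /andP[hu uA].
  have : deg F u < D by rewrite ltn_neqAle Fdeg andbT; move: hu; rewrite uA.
  apply: leq_trans; rewrite /deg.
  rewrite (_ : [set _ in e |: F | _]%SET = e |: [set f in F | u \in f]%SET).
    by rewrite cardsU1; case: (_ \notin _) => /=; lia.
  by apply/setP => f; rewrite !inE; case: eqVneq => // ->; rewrite ue.
by move=> /Fmax; rewrite cardsU1 eF /= ; lia.
Qed.
End Balancing.

(** * Primes *)

Section Primes.
Local Open Scope nat_scope.

Definition primes_upto (n : nat) : seq nat := [seq p <- iota 1 n | prime p].

Lemma leq_exp2_bin m : 2 ^ m <= 'C(m + m, m).
Proof.
rewrite -binomial.Vandermonde -[2]/(1 + 1) expnDn; apply: leq_sum => i _.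
by rewrite !exp1n !muln1 bin_sub ?leq_ord // leq_pmulr // bin_gt0 leq_ord.
Qed.

(** Legendre's formula: each power [p ^ k] up to [m + m] contributes at most one, and higher powers
    contribute nothing. *)
Lemma logn_bin_le p m : prime p -> logn p 'C(m + m, m) <= trunc_log p (m + m).
Proof.
move=> pp; set n := m + m; set t := trunc_log p n.
have := congr1 (logn p) (bin_fact (leq_addr m m)).
have mn : (m + m - m) = m by rewrite addnK.
rewrite mn !lognM ?muln_gt0 ?fact_gt0 ?bin_gt0 ?leq_addr // !logn_fact // -/n => E.
have hm : \sum_(1 <= k < m.+1) m %/ p ^ k = \sum_(1 <= k < n.+1) m %/ p ^ k.
  rewrite [RHS](big_cat_nat (n := m.+1)) //=; last by rewrite ltnS leq_addr.
  rewrite [X in _ + X]big_nat_cond [X in _ + X]big1 ?addn0 // => k /andP[/andP[hk _] _].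
  by rewrite divn_small // (leq_trans hk) // ltnW // ltn_expl // prime_gt1.
rewrite hm in E.
suff : \sum_(1 <= k < n.+1) n %/ p ^ k <= \sum_(1 <= k < n.+1) m %/ p ^ k
    + \sum_(1 <= k < n.+1) m %/ p ^ k + t by lia.
rewrite -big_split /=.
have -> : t = \sum_(1 <= k < t.+1) 1 by rewrite sum_nat_const_nat; lia.
have tn : t <= n.
  case: (posnP n) => [n0|n0]; first by rewrite /t n0 trunc_log0.
  by have := trunc_logP (prime_gt1 pp) n0; have := ltn_expl t (prime_gt1 pp); rewrite -/t; lia.
rewrite [X in X <= _](big_cat_nat (n := t.+1)) // [X in _ <= X + _](big_cat_nat (n := t.+1)) //=.
have -> : \sum_(t.+1 <= k < n.+1) n %/ p ^ k = 0.
  rewrite big_nat_cond big1 // => k /andP[/andP[hk _] _].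
  rewrite divn_small // (leq_trans (trunc_log_ltn n (prime_gt1 pp))) //.
  by rewrite leq_exp2l // prime_gt1.
rewrite addn0 addnAC; apply: leq_trans (leq_addr _ _); rewrite -big_split /=.
apply: leq_sum => k _; have q0 : 0 < p ^ k by rewrite expn_gt0 prime_gt0.
have := ltn_pmod m q0; have := divn_eq m (p ^ k).
set a := m %/ p ^ k; set b := m %% p ^ k => Em hb.
rewrite -ltnS ltn_divLR // /n {1 2}Em; lia.
Qed.

(** Chebyshev's lower bound for the number of primes: every prime power in the factorisation of
    ['C(m + m, m)] is at most [m + m], and only primes up to [m + m] occur in it. *)
Lemma leq_exp2_primes_upto m :
  0 < m -> 2 ^ m <= (m + m) ^ size (primes_upto (m + m)).
Proof.
move=> m0; apply: leq_trans (leq_exp2_bin m) _.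
have C0 : 0 < 'C(m + m, m) by rewrite bin_gt0 leq_addr.
rewrite {1}(prod_prime_decomp C0) prime_decompE big_map /=.
apply: (@leq_trans (\prod_(p <- primes 'C(m + m, m)) (m + m))).
  rewrite big_seq [leqRHS]big_seq; apply: leq_prod => p.
  rewrite mem_primes => /and3P[pp _ _].
  apply: leq_trans (trunc_logP (prime_gt1 pp) _); last by lia.
  by rewrite leq_exp2l ?prime_gt1 // logn_bin_le.
rewrite big_const_seq count_predT iter_muln_1 leq_pexp2l //; first by lia.
apply: uniq_leq_size (primes_uniq _) _ => p; rewrite mem_primes => /and3P[pp _ pC].
rewrite mem_filter pp mem_iota /= prime_gt0 // add1n ltnS leqNgt; apply/negP => hp.
have : p %| (m + m)`! by rewrite -(bin_fact (leq_addr m m)) dvdn_mulr.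
elim: (m + m) hp => [|i IH] hp; first by rewrite dvdn1 => /eqP p1; rewrite p1 in pp.
rewrite factS Euclid_dvdM // gtnNdvd //=; exact/IH/ltnW.
Qed.

Lemma size_prime_divisors (s : seq nat) w :
  uniq s -> 0 < w -> (forall p, p \in s -> prime p /\ p %| w) -> 2 ^ size s <= w.
Proof.
move=> us w0 hs; apply: (@leq_trans (2 ^ size (primes w))).
  rewrite leq_exp2l //; apply: uniq_leq_size us _ => p /hs[pp pw].
  by rewrite mem_primes pp w0.
rewrite [leqRHS](prod_prime_decomp w0) prime_decompE big_map /=.
rewrite -[2 ^ _]iter_muln_1 -count_predT -big_const_seq.
rewrite big_seq [leqRHS]big_seq; apply: leq_prod => p; rewrite mem_primes => /and3P[pp _ pw].
apply: leq_trans (prime_gt1 pp) _; rewrite -{1}[p]expn1 leq_exp2l ?prime_gt1 //.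
by rewrite -pfactor_dvdn ?expn1.
Qed.
End Primes.

(** * Digits and spheres *)

Section Digits.
Local Open Scope nat_scope.

Definition digit_sum (b D : nat) (f : 'I_D -> nat) := \sum_(i < D) f i * b ^ i.

Lemma digit_sum_inj b D (f g : 'I_D -> nat) :
  (forall i, f i < b) -> (forall i, g i < b) ->
  digit_sum b f = digit_sum b g -> f =1 g.
Proof.
rewrite /digit_sum; elim: D f g => [|D IH] f g fb gb; first by move=> _ [].
rewrite !big_ord_recl /= !expn0 !muln1.
have shift (h : 'I_D.+1 -> nat) : \sum_(i < D) h (lift ord0 i) * b ^ bump 0 i =
    (\sum_(i < D) h (lift ord0 i) * b ^ i) * b.
  by rewrite big_distrl /=; apply: eq_bigr => i _; rewrite /bump /= expnSr mulnA.
rewrite !shift => E.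
have b0 : 0 < b by apply: leq_ltn_trans (fb ord0).
have E0 : f ord0 = g ord0.
  have := congr1 (modn^~ b) E.
  by rewrite ![_ + _ * b]addnC !modnMDl !modn_small.
move: E; rewrite E0 => /addnI/eqP; rewrite eqn_pmul2r // => /eqP E i.
case: (unliftP ord0 i) => [j ->|->] //.
exact: (IH (fun i => f (lift ord0 i)) (fun i => g (lift ord0 i))).
Qed.

Lemma digit_sum_lt b D (f : 'I_D -> nat) :
  (forall i, f i < b) -> digit_sum b f < b ^ D.
Proof.
rewrite /digit_sum; elim: D f => [|D IH] f fb; first by rewrite big_ord0.
rewrite big_ord_recr /= expnS -addSn.
apply: leq_trans (leq_mul (fb ord_max) (leqnn (b ^ D))); rewrite mulSn leq_add2r.
exact: (IH (fun i => f (widen_ord (leqnSn D) i))).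
Qed.

(* Strict convexity of the sphere: [l1 l2 (x - y)^2] is the defect of
   convexity of the square, and it sums to zero on a sphere. *)
Lemma sphere_strictly_convex D (x y z : 'I_D -> nat) l1 l2 rho :
  0 < l1 -> 0 < l2 -> (forall i, l1 * x i + l2 * y i = (l1 + l2) * z i) ->
  \sum_i x i ^ 2 = rho -> \sum_i y i ^ 2 = rho -> \sum_i z i ^ 2 = rho ->
  x =1 y.
Proof.
move=> l10 l20 hxy hx hy hz.
pose dist i := (x i - y i) + (y i - x i).
have pw i : l1 * l2 * dist i ^ 2 + (l1 + l2) * (l1 + l2) * z i ^ 2 =
    (l1 + l2) * l1 * x i ^ 2 + (l1 + l2) * l2 * y i ^ 2.
  have -> : (l1 + l2) * (l1 + l2) * z i ^ 2 = (l1 * x i + l2 * y i) ^ 2.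
    by rewrite hxy -!mulnn; lia.
  rewrite /dist -!mulnn; case: (leqP (x i) (y i)) => [h|/ltnW h].
    by rewrite -(subnK h); move: (y i - x i) => t; rewrite addnK (_ : x i - _ = 0); lia.
  by rewrite -(subnK h); move: (x i - y i) => t; rewrite addnK (_ : y i - _ = 0); lia.
have : \sum_i (l1 * l2 * dist i ^ 2 + (l1 + l2) * (l1 + l2) * z i ^ 2) =
    \sum_i ((l1 + l2) * l1 * x i ^ 2 + (l1 + l2) * l2 * y i ^ 2).
  by apply: eq_bigr.
rewrite !big_split /= -!big_distrr /= hx hy hz => E.
have : \sum_i dist i ^ 2 == 0.
  rewrite -(eqn_pmul2l (_ : 0 < l1 * l2)) ?muln_gt0 ?l10 // muln0.
  by move: E; move: (\sum_(i < D) _) => S E; apply/eqP; lia.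
rewrite sum_nat_eq0 => /forallP h i; have := h i.
by rewrite expn_eq0 /dist addn_eq0 !subn_eq0 => /andP[/andP[h1 h2] _]; apply/eqP; rewrite eqn_leq h1.
Qed.
End Digits.

(** * Copies and supersaturation *)

(** Labels form a relation, so that each use can describe them by their properties; a labelling
    function is chosen only here. *)
Lemma leq_card_labels (U T : finType) (E : {set U}) (lab : U -> T -> Prop) :
  (forall e, e \in E -> exists t, lab e t) ->
  (forall e e' t, e \in E -> e' \in E -> lab e t -> lab e' t -> e = e') ->
  (#|E| <= #|T|)%N.
Proof.
move=> hex huniq; case: (set_0Vmem E) => [->|[e0 e0E]]; first by rewrite cards0.
have /boolp.choice[f hf] : forall e, exists t, e \in E -> lab e t.
  move=> e; case: (boolP (e \in E)) => [/hex[t ht]|_].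
    by exists t.
  by have [t _] := hex _ e0E; exists t.
rewrite -(card_in_imset (f := f)) ?max_card // => e e' eE e'E ff.
by apply: (huniq e e' (f e)) => //; [exact: hf|rewrite ff; exact: hf].
Qed.

Section Copies.
Variables (R : realType) (d : nat) (X : {fset 'rV[nat]_d}).

Definition pt n (p : 'rV['I_n]_d) : 'rV[R]_d := real_vec R (grid_point p).

Lemma ptE n (p : 'rV['I_n]_d) j : pt p 0 j = (p 0 j).+1%:R.
Proof. by rewrite !mxE. Qed.

Lemma pt_inj n : injective (@pt n).
Proof.
move=> p p' /rowP h; apply/rowP => j; apply: val_inj.
by have /eqP := h j; rewrite !ptE eqr_nat eqSS => /eqP.
Qed.

Definition is_copy n (e : {set 'rV['I_n]_d}) (b : 'rV[R]_d) (r : R) : Prop :=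
  [/\ 0 < r,
      forall x, x \in X -> exists2 p, p \in e & pt p = b + r *: real_vec R x &
      forall p, p \in e -> exists2 x, x \in X & pt p = b + r *: real_vec R x].

Definition copies n : {set {set 'rV['I_n]_d}} :=
  [set e | `[< exists b r, is_copy e b r >]]%SET.

Definition copies_in n (A : {set 'rV['I_n]_d}) : {set {set 'rV['I_n]_d}} :=
  [set e in copies n | e \subset A]%SET.

(** This makes the free sets the independent sets of the hypergraph [copies n]. A real copy covered
    by [A] is traced back to an edge by keeping the points of [A] that lie on it. *)
Lemma free_setsP n (A : {set 'rV['I_n]_d}) :
  reflect (forall e, e \in copies n -> ~~ (e \subset A)) (A \in free_sets R X n).
Proof.
rewrite inE; apply: (iffP (asboolP _)) => [free e|hA b r r0 rn0 hsub].
  rewrite inE => /asboolP[b [r [r0 hX he]]]; apply/negP => /fintype.subsetP eA.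
  apply: (free b r); rewrite ?ltW ?gt_eqF // => _ [x xX <-].
  have [p pe hp] := hX x xX; rewrite -hp.
  by exists (grid_point p) => //; exists p => //; apply: eA.
pose e := [set p in A | `[< exists2 x, x \in X & pt p = b + r *: real_vec R x >]]%SET.
have : e \subset A by apply/fintype.subsetP => p; rewrite inE => /andP[].
apply/negP/hA; rewrite inE; apply/asboolP; exists b, r; split.
- by rewrite lt_neqAle eq_sym rn0.
- move=> x xX; have [_ [p pA <-] hp] : (@real_vec R d @` (@grid_point n d @` [set` A]))%classic
      (b + r *: real_vec R x) by apply: hsub; exists x.
  by exists p => //; rewrite inE pA; apply/asboolP; exists x.
- by move=> p; rewrite inE => /andP[_ /asboolP].
Qed.

Lemma copy_ext n (e e' : {set 'rV['I_n]_d}) b r :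
  is_copy e b r -> is_copy e' b r -> e = e'.
Proof.
suff h (e1 e2 : {set 'rV['I_n]_d}) : is_copy e1 b r -> is_copy e2 b r -> e1 \subset e2.
  by move=> he he'; apply/eqP; rewrite finset.eqEsubset (h _ _ he he') (h _ _ he' he).
move=> [_ _ h1] [_ h2 _]; apply/fintype.subsetP => p /h1[x xX hp].
by have [p' p'e] := h2 x xX; rewrite -hp => /pt_inj <-.
Qed.

Lemma card_copy_le n e : e \in copies n -> (#|e| <= #|` X|)%N.
Proof.
rewrite inE => /asboolP[b [r [_ _ he]]]; rewrite cardfE.
apply: (leq_card_labels (lab := fun p (x : X) => pt p = b + r *: real_vec R (val x))).
  by move=> p /he[x xX hp]; exists [` xX]%fset.
by move=> p p' x _ _ <- /pt_inj ->.
Qed.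

Lemma real_vec_inj : injective (@real_vec R d).
Proof.
move=> x x' /rowP h; apply/rowP => j.
by have /eqP := h j; rewrite !mxE eqr_nat => /eqP.
Qed.

(** The preimages of [u] and [v] in [X] serve as a label: the difference of the two points then
    fixes the ratio [r], and [u] fixes the shift [b]. *)
Lemma codegree_copies n (u v : 'rV['I_n]_d) : u != v ->
  (#|[set e in copies n | (u \in e) && (v \in e)]%SET| <= #|` X| * #|` X|)%N.
Proof.
move=> uv; rewrite cardfE -card_prod.
pose lab (e : {set 'rV['I_n]_d}) (t : X * X) := exists b r,
  [/\ is_copy e b r, pt u = b + r *: real_vec R (val t.1) &
      pt v = b + r *: real_vec R (val t.2)].
apply: (leq_card_labels (lab := lab)).
  move=> e; rewrite !inE => /and3P[/asboolP[b [r hc]] ue ve].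
  case: (hc) => _ _ he; have [x xX hu] := he u ue; have [x' xX' hv] := he v ve.
  by exists ([` xX]%fset, [` xX']%fset), b, r.
move=> e e' [x x'] _ _ [b [r [hc hu hv]]] [b' [r' [hc' hu' hv']]] /=.
have /rV0Pn[j] : real_vec R (val x) - real_vec R (val x') != 0.
  rewrite subr_eq0; apply: contra uv => /eqP E.
  by apply/eqP/pt_inj; rewrite hu hv /= E.
move=> hj; have huv : r *: (real_vec R (val x) - real_vec R (val x')) =
    r' *: (real_vec R (val x) - real_vec R (val x')).
  transitivity (pt u - pt v); first by rewrite hu hv /= opprD addrACA subrr add0r scalerBr.
  by rewrite hu' hv' /= opprD addrACA subrr add0r scalerBr.
have rr' : r = r'.
  have /rowP/(_ j) := huv; rewrite !mxE; apply: mulIf.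
  by move: hj; rewrite !mxE.
rewrite -rr' in hc' hu'.
have bb' : b = b' by apply: (addIr (r *: real_vec R (val x))); rewrite -hu hu'.
by rewrite -bb' in hc'; apply: copy_ext hc hc'.
Qed.

Lemma max_free_ge n A : A \in free_sets R X n -> (#|A| <= max_free R X n)%N.
Proof. by move=> hA; rewrite /max_free; apply: leq_bigmax_cond. Qed.

(** Deletion argument: as long as [B] contains a copy, removing one of its points destroys at least
    one copy. *)
Lemma card_le_max_free n (B : {set 'rV['I_n]_d}) : (0 < #|` X|)%N ->
  (#|B| <= max_free R X n + #|copies_in B|)%N.
Proof.
move=> X0; move: {2}#|B| (leqnn #|B|) => m.
elim: m B => [|m IH] B hB; first by lia.
have [BF|] := boolP (B \in free_sets R X n); first by rewrite (leq_trans (max_free_ge BF)) ?leq_addr.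
move=> hnF; have [e ec eB] : exists2 e, e \in copies n & e \subset B.
  apply: contrapT => h; case/negP: hnF; apply/free_setsP => e ec; apply/negP => eB.
  by apply: h; exists e.
have [p pe] : exists p, p \in e.
  move: (ec); rewrite inE => /asboolP[b [r [_ hX _]]].
  have /fset0Pn[x xX] : X != fset0%fset by rewrite -cardfs_gt0.
  by have [p pe _] := hX x xX; exists p.
have pB : p \in B by apply: (fintype.subsetP eB).
have := cardsD1 p B; rewrite pB => cB.
have cc : (#|copies_in (B :\ p)| < #|copies_in B|)%N.
  apply: proper_card; apply/fintype.properP; split.
    apply/fintype.subsetP => e'; rewrite !inE => /andP[->] /= h.
    exact: fintype.subset_trans h (finset.subsetDl _ _).
  exists e; first by rewrite inE ec.
  rewrite inE ec /=; apply/negP => /fintype.subsetP/(_ p pe).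
  by rewrite !inE eqxx.
by have := IH (B :\ p); lia.
Qed.

(** * Dilated boxes in the grid and the copies inside them *)

Section Dilation.
Variables (n M : nat).
Implicit Types (q : nat) (c : 'rV['I_(n + n)]_d) (y : 'rV['I_M]_d).
Implicit Types (p : 'rV['I_n]_d) (A : {set 'rV['I_n]_d}) (e : {set 'rV['I_M]_d}).
Local Open Scope nat_scope.

(* [on_dilate q c y p] says p = (c - n) + q y; the offset [n] makes all the
   positions of a dilated box that meet the grid nonnegative. *)
Definition on_dilate (q : nat) (c : 'rV['I_(n + n)]_d) (y : 'rV['I_M]_d)
    (p : 'rV['I_n]_d) : bool :=
  [forall j, p 0%R j + n == c 0%R j + q * y 0%R j].

Lemma on_dilateP q c y p :
  reflect (forall j, p 0%R j + n = c 0%R j + q * y 0%R j) (on_dilate q c y p).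
Proof. by apply: (iffP forallP) => h j; apply/eqP/h. Qed.

Definition box (A : {set 'rV['I_n]_d}) q c : {set 'rV['I_M]_d} :=
  [set y | [exists p in A, on_dilate q c y p]]%SET.

Definition dilate (e' : {set 'rV['I_M]_d}) q c : {set 'rV['I_n]_d} :=
  [set p | [exists y in e', on_dilate q c y p]]%SET.

Lemma on_dilate_fun q c y p (p' : 'rV['I_n]_d) :
  on_dilate q c y p -> on_dilate q c y p' -> p = p'.
Proof.
move=> /on_dilateP h /on_dilateP h'; apply/rowP => j; apply: val_inj.
by have := h j; have := h' j; rewrite /=; lia.
Qed.

Lemma on_dilate_inj q c y (y' : 'rV['I_M]_d) p : 0 < q ->
  on_dilate q c y p -> on_dilate q c y' p -> y = y'.
Proof.
move=> q0 /on_dilateP h /on_dilateP h'; apply/rowP => j; apply: val_inj.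
have := h j; rewrite h' => /addnI/eqP; rewrite eqn_pmul2l // => /eqP E.
exact: esym.
Qed.

Lemma on_dilate_base q c (c' : 'rV['I_(n + n)]_d) y p :
  on_dilate q c y p -> on_dilate q c' y p -> c = c'.
Proof.
move=> /on_dilateP h /on_dilateP h'; apply/rowP => j; apply: val_inj.
by have := h j; have := h' j; rewrite /=; lia.
Qed.

Lemma on_dilate_ex q y (p : 'rV['I_n]_d) : q * M <= n -> exists c, on_dilate q c y p.
Proof.
move=> qM; have hc j : p 0%R j + n - q * y 0%R j < n + n.
  by rewrite (leq_ltn_trans (leq_subr _ _)) // ltn_add2r.
exists (\row_j Ordinal (hc j))%R; apply/on_dilateP => j; rewrite mxE /= subnK //.
apply: leq_trans (leq_addl _ _); apply: leq_trans qM.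
by rewrite leq_mul2l ltnW ?orbT.
Qed.

(** Indices are one less than coordinates at both scales, which accounts for the [1 - q] in the
    shift. *)
Lemma pt_dilate q c y p : on_dilate q c y p ->
  (pt p = (\row_j ((c 0%R j)%:R - n%:R + 1 - q%:R)) + q%:R *: pt y :> 'rV[R]_d)%R.
Proof.
move=> /on_dilateP h; apply/rowP => j; rewrite ptE !mxE.
have := congr1 (fun i => i%:R : R)%R (h j); rewrite /= !natrD natrM => E.
by rewrite -[(p 0%R j).+1]addn1 -[(y 0%R j).+1]addn1 !natrD mulrDr mulr1; lra.
Qed.

Lemma dilate_copy A e' q c : 0 < q -> e' \in copies M -> e' \subset box A q c ->
  dilate e' q c \in copies_in A.
Proof.
move=> q0; rewrite !inE => [[b [r [r0 hX he]]]] /fintype.subsetP e'B.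
apply/andP; split; last first.
  apply/fintype.subsetP => p; rewrite inE => /existsP[y /andP[/e'B]].
  rewrite inE => /existsP[p' /andP[p'A hp']] hp.
  by rewrite (on_dilate_fun hp hp').
set b0 : 'rV[R]_d := (\row_j ((c 0%R j)%:R - n%:R + 1 - q%:R))%R.
apply/asboolP; exists (b0 + q%:R *: b)%R, (q%:R * r)%R.
have E x : (b0 + q%:R *: b + (q%:R * r) *: x = b0 + q%:R *: (b + r *: x))%R.
  by rewrite scalerDr scalerA addrA.
split; first by rewrite mulr_gt0 // ltr0n.
  move=> x /hX[y ye' hy]; have := e'B y ye'; rewrite inE => /existsP[p /andP[_ hp]].
  exists p; first by rewrite inE; apply/existsP; exists y; rewrite ye'.
  by rewrite (pt_dilate hp) hy E.
move=> p; rewrite inE => /existsP[y /andP[/he[x xX hy] hp]].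
by exists x => //; rewrite (pt_dilate hp) hy E.
Qed.

(** Double counting: each pair of a point [p] of [A] and a box index [y] has a position [c] that
    puts [y] on [p], and [(c, y)] recovers [p]. The bound on [q * M] keeps this position in
    range. *)
Lemma sum_card_box A q : q * M <= n ->
  #|A| * M ^ d <= \sum_c #|box A q c|.
Proof.
move=> qM.
have -> : #|A| * M ^ d = #|finset.setX A [set: 'rV['I_M]_d]%SET|.
  by rewrite cardsX cardsT card_mx card_ord mul1n.
have -> : \sum_c #|box A q c| =
    #|[set cy : 'rV['I_(n + n)]_d * 'rV['I_M]_d | cy.2 \in box A q cy.1]%SET|.
  rewrite -sum1_card (eq_bigl (fun cy => cy.2 \in box A q cy.1)); last by move=> cy; rewrite inE.
  rewrite -(pair_big_dep xpredT (fun c y => y \in box A q c) (fun _ _ => 1)) /=.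
  by apply: eq_bigr => c _; rewrite sum1_card.
have /boolp.choice[f hf] : forall py : 'rV['I_n]_d * 'rV['I_M]_d,
    exists c, on_dilate q c py.2 py.1 by move=> py; apply: on_dilate_ex.
rewrite -(card_in_imset (f := fun py => (f py, py.2))); last first.
  move=> [p y] [p' y'] _ _ [ff yy]; have := hf (p, y); have := hf (p', y').
  by rewrite /= -ff -yy => h' h; rewrite (on_dilate_fun h h').
apply/subset_leq_card/fintype.subsetP => cy /imsetP[[p y]].
rewrite !inE => /andP[pA _] ->; apply/existsP; exists p; rewrite pA.
exact: (hf (p, y)).
Qed.
End Dilation.

Section Supersaturation.
Local Open Scope nat_scope.

(** For each [q] the boxes together hold at least twice what free sets could, so deletion yields at
    least half of [#|A| * M ^ d] pairs of a position and a copy in its box. A copy in [A] arises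
    from at most [M ^ d] such pairs for one [q], and for at most [t] of the primes. *)
Lemma supersaturation n M t (Q : seq nat) (A : {set 'rV['I_n]_d}) :
  (1 < #|` X|)%N -> (n <= 2 ^ t)%N -> uniq Q -> (forall q, q \in Q -> prime q /\ (q * M <= n)%N) ->
  (0 < M)%N ->
  (2 * ((n + n) ^ d * max_free R X M) <= #|A| * M ^ d)%N ->
  (size Q * #|A| <= 2 * (t * #|copies_in A|))%N.
Proof.
move=> X1 nt uQ hQ M0 hA.
have X0 : 0 < #|` X| by lia.
pose T : finType := ('rV['I_(n + n)]_d * {set 'rV['I_M]_d})%type.
pose S q : {set T} :=
  [set ce | (ce.2 \in copies M) && (ce.2 \subset box M A q ce.1)]%SET.
have inS q c e' (e : {set 'rV['I_n]_d}) :
    ((c, e') \in [set ce in S q | dilate ce.2 q ce.1 == e]%SET) =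
    [&& e' \in copies M, e' \subset box M A q c & dilate e' q c == e].
  by rewrite inE [_ \in S q]inE -andbA.
have hS q : q \in Q -> #|A| * M ^ d <= 2 * #|S q|.
  move=> /hQ[_ qM].
  have h1 := sum_card_box A qM.
  have h2 : \sum_c #|box M A q c| <=
      \sum_(c : 'rV['I_(n + n)]_d) (max_free R X M + #|copies_in (box M A q c)|).
    by apply: leq_sum => c _; apply: card_le_max_free.
  have h3 : \sum_(c : 'rV['I_(n + n)]_d) #|copies_in (box M A q c)| = #|S q|.
    rewrite -[RHS]sum1_card
      (eq_bigl (fun ce : T => ce.2 \in copies_in (box M A q ce.1))); last first.
      by move=> ce; rewrite !inE.
    rewrite -(pair_big_dep xpredT (fun c e => e \in copies_in (box M A q c)) (fun _ _ => 1)) /=.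
    by apply: eq_bigr => c _; rewrite sum1_card.
  rewrite big_split /= h3 sum_nat_const card_mx card_ord mul1n in h2.
  by move: (leq_trans h1 h2) hA; lia.
(* A fixed point [p] of [e] labels each pair by a box index that lands on it; this index determines
   the position, and then the copy in the box is recovered from its image. *)
have hfib (e : {set 'rV['I_n]_d}) q : q \in Q -> #|[set ce in S q | dilate ce.2 q ce.1 == e]%SET| <= M ^ d.
  move=> /hQ[qp _]; have q0 := prime_gt0 qp.
  have [->|[[c1 e1]]] := set_0Vmem [set ce in S q | dilate ce.2 q ce.1 == e]%SET.
    by rewrite cards0.
  rewrite inS => /and3P[ec eB /eqP Ee].
  have [p pe] : exists p, p \in e.
    have := dilate_copy q0 ec eB; rewrite Ee inE => /andP[].
    rewrite inE => /asboolP[b [r [_ hX _]]] _.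
    have /fset0Pn[x xX] : X != fset0%fset by rewrite -cardfs_gt0.
    by have [p pe _] := hX x xX; exists p.
  have -> : M ^ d = #|{: 'rV['I_M]_d}| by rewrite card_mx card_ord mul1n.
  apply: (leq_card_labels (lab := fun (ce : T) y => on_dilate q ce.1 y p)).
    move=> [c e']; rewrite inS => /and3P[_ _ /eqP E].
    by move: pe; rewrite -E inE => /existsP[y /andP[_ hy]]; exists y.
  move=> [c e'] [c' e''] y; rewrite !inS.
  move=> /and3P[_ /fintype.subsetP b1 /eqP E1] /and3P[_ /fintype.subsetP b2 /eqP E2] h1 h2.
  have /= cc := on_dilate_base h1 h2; rewrite -cc in b2 E2 *.
  suff sub (f1 f2 : {set 'rV['I_M]_d}) : {subset f1 <= box M A q c} ->
      dilate f1 q c = dilate f2 q c -> f1 \subset f2.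
    by congr (_, _); apply/eqP; rewrite finset.eqEsubset !sub // E1 E2.
  move=> fB ff; apply/fintype.subsetP => z zf.
  have := fB z zf; rewrite inE => /existsP[p' /andP[_ hp']].
  have : p' \in dilate f1 q c by rewrite inE; apply/existsP; exists z; rewrite zf.
  rewrite ff inE => /existsP[z' /andP[z'f hz']].
  by rewrite (on_dilate_inj q0 hp' hz').
(* Two points of a copy differ in some coordinate; the distance there is positive and below [n], and
   every [q] that produces the copy divides it. *)
have hdiv e : e \in copies_in A ->
    exists2 w, 0 < w <= n & forall q, q \in Q ->
      0 < #|[set ce in S q | dilate ce.2 q ce.1 == e]%SET| -> q %| w.
  rewrite inE => /andP[]; rewrite inE => /asboolP[b [r [r0 hX _]]] _.
  have [x [x' [xX x'X xx']]] : exists x x', [/\ x \in X, x' \in X & x != x'].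
    have /fset0Pn[x xX] : X != fset0%fset by rewrite -cardfs_gt0.
    have : 0 < #|` (X `\ x)%fset| by have := cardfsD1 x X; rewrite xX; lia.
    rewrite cardfs_gt0 => /fset0Pn[x']; rewrite !inE => /andP[h x'X].
    by exists x, x'; rewrite eq_sym.
  have [p pe hp] := hX x xX; have [p' p'e hp'] := hX x' x'X.
  have pp' : p != p'.
    apply: contra xx' => /eqP E; apply/eqP/real_vec_inj.
    move: hp'; rewrite -E hp => /addrI/scalerI; apply; first by rewrite gt_eqF.
  have [j hj] : exists j, p 0%R j != p' 0%R j.
    apply: contrapT => h; case/negP: pp'; apply/eqP/rowP => j.
    by apply/eqP/negPn/negP => hj; apply: h; exists j.
  exists ((p 0%R j - p' 0%R j) + (p' 0%R j - p 0%R j)).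
    move: hj (ltn_ord (p 0%R j)) (ltn_ord (p' 0%R j)); rewrite -val_eqE /=.
    by move: (nat_of_ord _) (nat_of_ord _) => a b'; lia.
  move=> q _ /card_gt0P[[c e']]; rewrite inS => /and3P[_ _ /eqP E].
  move: pe p'e; rewrite -E !inE => /existsP[y /andP[_ /on_dilateP hy]].
  move=> /existsP[y' /andP[_ /on_dilateP hy']].
  have -> : (p 0%R j - p' 0%R j) + (p' 0%R j - p 0%R j) =
      q * ((y 0%R j - y' 0%R j) + (y' 0%R j - y 0%R j)).
    move: (hy j) (hy' j); rewrite /= mulnDr !mulnBr.
    move: (q * y 0%R j) (q * y' 0%R j) (nat_of_ord (c 0%R j)) => a a' b'.
    by move: (nat_of_ord _) (nat_of_ord _) => i i'; lia.
  exact: dvdn_mulr.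
have hsum : \sum_(q <- Q) #|S q| <= t * #|copies_in A| * M ^ d.
  have -> : \sum_(q <- Q) #|S q| = \sum_(q <- Q) \sum_(e in copies_in A)
      #|[set ce in S q | dilate ce.2 q ce.1 == e]%SET|.
    rewrite big_seq [RHS]big_seq; apply: eq_bigr => q /hQ[qp _].
    rewrite -sum1_card (partition_big (fun ce : T => dilate ce.2 q ce.1) (mem (copies_in A))) /=.
      by apply: eq_bigr => e _; rewrite -sum1_card; apply: eq_bigl => ce; rewrite !inE.
    by move=> ce; rewrite inE => /andP[h1 h2]; apply: dilate_copy (prime_gt0 qp) h1 h2.
  rewrite exchange_big /= -mulnA mulnCA -sum_nat_const; apply: leq_sum => e eA.
  have [w /andP[w0 wn] hw] := hdiv e eA.
  pose D := [seq q <- Q | 0 < #|[set ce in S q | dilate ce.2 q ce.1 == e]%SET|].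
  have hD : size D <= t.
    have : 2 ^ size D <= 2 ^ t.
      apply: leq_trans nt; apply: leq_trans wn; apply: size_prime_divisors => //.
        exact: filter_uniq.
      by move=> q; rewrite mem_filter => /andP[h qQ]; split; [case: (hQ q qQ)|apply: hw].
    by rewrite leq_exp2l.
  rewrite (bigID (fun q => 0 < #|[set ce in S q | dilate ce.2 q ce.1 == e]%SET|)) /=.
  rewrite [X in _ + X]big1 ?addn0; last by move=> q; rewrite -eqn0Ngt => /eqP.
  rewrite -big_filter -/D; apply: leq_trans (_ : size D * M ^ d <= _); last first.
    by rewrite leq_mul2r hD orbT.
  rewrite -sum1_size big_distrl /= big_seq [leqRHS]big_seq; apply: leq_sum => q.
  by rewrite mem_filter mul1n => /andP[_ qQ]; apply: hfib.
have : size Q * (#|A| * M ^ d) <= \sum_(q <- Q) 2 * #|S q|.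
  rewrite -sum1_size big_distrl /= big_seq [leqRHS]big_seq; apply: leq_sum => q.
  by rewrite mul1n; apply: hS.
rewrite -big_distrr /= => h.
have Md : 0 < M ^ d by rewrite expn_gt0 M0.
rewrite -(leq_pmul2r Md); apply: leq_trans (_ : 2 * (t * #|copies_in A| * M ^ d) <= _).
  by rewrite -mulnA; apply: leq_trans h _; rewrite leq_mul2l hsum.
by rewrite !mulnA.
Qed.
End Supersaturation.

(** * Lower bound and good scales *)

Lemma exists_coord_bound :
  exists B : nat, forall x, x \in X -> forall j, (x 0%R j < B)%N.
Proof.
exists (\max_(x : X) \max_j val x 0%R j).+1%N => x xX j; rewrite ltnS.
apply: leq_trans (leq_bigmax_cond (F := fun x : X => \max_j val x 0%R j)%N [` xX]%fset isT).
exact: (leq_bigmax_cond (F := fun j => x 0%R j) j isT).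
Qed.

Lemma exists_three_values (phi : 'rV[nat]_d -> nat) :
  {in X &, injective phi} -> (2 < #|` X|)%N ->
  exists x z y, [/\ x \in X, z \in X, y \in X, (phi x < phi z)%N & (phi z < phi y)%N].
Proof.
move=> phi_inj X3; pose s := sort leq [seq phi x | x <- X].
have sz : (2 < size s)%N by rewrite size_sort size_map.
have ss : sorted ltn s.
  rewrite ltn_sorted_uniq_leq sort_uniq (sort_sorted leq_total) andbT.
  by rewrite map_inj_in_uniq ?fset_uniq.
have im a : a \in s -> exists2 x, x \in X & a = phi x.
  by rewrite mem_sort => /mapP.
case: s sz ss im => [|a [|c [|b s]]] //= _ /and3P[ac cb _] im.
have [|x xX ax] := im a; first by rewrite inE eqxx.
have [|z zX cz] := im c; first by rewrite !inE eqxx orbT.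
have [|y yX yb] := im b; first by rewrite !inE eqxx !orbT.
by exists x, z, y; rewrite -ax -cz -yb.
Qed.

(** The real linear extension of the base-[B] digit sum; it turns copies of [X] into copies of a set
    of integers. *)
Definition real_functional (B : nat) (v : 'rV[R]_d) : R :=
  \sum_(j < d) v 0 j * (B ^ j)%:R.

Lemma real_functionalD B v w :
  real_functional B (v + w) = real_functional B v + real_functional B w.
Proof.
by rewrite /real_functional -big_split; apply: eq_bigr => j _; rewrite mxE mulrDl.
Qed.

Lemma real_functionalZ B r v :
  real_functional B (r *: v) = r * real_functional B v.
Proof.
by rewrite /real_functional mulr_sumr; apply: eq_bigr => j _; rewrite mxE mulrA.
Qed.

Lemma real_functional_vec B (x : 'rV[nat]_d) :
  real_functional B (real_vec R x) = (digit_sum B (fun j => x 0%R j))%:R.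
Proof.
by rewrite /real_functional natr_sum; apply: eq_bigr => j _; rewrite mxE natrM.
Qed.

Section Behrend.
Local Open Scope nat_scope.

(* Behrend's construction: a generic linear functional maps three points of [X]
   to distinct integers, so a copy of [X] yields a proper convex combination;
   the points of the grid whose (shifted) image has its digit vector on a
   sphere therefore contain no copy. The shift and the radius come from one
   pigeonhole over all pairs (grid point, digit vector). *)
Lemma behrend_bound : (2 < #|` X|)%N ->
  exists C m0 : nat, forall m, (m0 <= m)%N ->
    ((2 ^ (m * m)) ^ d <= max_free R X (2 ^ (m * m)) * 2 ^ (C * m))%N.
Proof.
move=> X3; have [B hB] := exists_coord_bound.
pose phi (x : 'rV[nat]_d) := digit_sum B (fun j => x 0%R j).
have phi_inj : {in X &, injective phi}.
  move=> x y xX yX /digit_sum_inj E; apply/rowP => j.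
  by apply: E => i; apply: hB.
have [x [z [y [xX zX yX xz zy]]]] := exists_three_values phi_inj X3.
(* The weights satisfy [l1 * phi x + l2 * phi y = (l1 + l2) * phi z], a relation that every copy
   inherits. *)
set l1 := phi y - phi z; set l2 := phi z - phi x.
have l10 : 0 < l1 by rewrite subn_gt0.
have l20 : 0 < l2 by rewrite subn_gt0.
pose h := l1 + l2; pose W := \sum_(j < d) B ^ j.
(* The losses are [2 ^ (h * m)] for restricting the digits to values below [2 ^ (m - h)], [2 ^ m]
   for the range of shifts and [2 ^ (3 * m)] for the radii. *)
exists (h + 4), (h + W + 2) => m hm.
set n := 2 ^ (m * m); set b := 2 ^ (m - h).
have b0 : 0 < b by rewrite expn_gt0.
have n0 : 0 < n by rewrite expn_gt0.
have nE : n = (2 ^ m) ^ m by rewrite -expnM.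
(* Weighted sums of digits stay below the base [2 ^ m], so no carries occur. *)
have hlb : (l1 + l2) * b <= 2 ^ m.
  have -> : 2 ^ m = 2 ^ h * b by rewrite -expnD; congr (2 ^ _); lia.
  by rewrite leq_mul2r ltnW ?orbT // ltn_expl.
pose val_of (s : {ffun 'I_m -> 'I_b}) := digit_sum (2 ^ m) (fun i => s i : nat).
pose norm_of (s : {ffun 'I_m -> 'I_b}) := \sum_i (s i : nat) ^ 2.
have bm : b <= 2 ^ m by rewrite leq_exp2l // leq_subr.
have val_lt s : val_of s < n.
  by rewrite nE; apply: digit_sum_lt => i; apply: leq_trans bm.
have phi_le (p : 'rV['I_n]_d) : phi (grid_point p) <= n * W.
  rewrite /phi /digit_sum /W big_distrr /=; apply: leq_sum => j _.
  by rewrite leq_mul2r mxE ltn_ord orbT.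
have norm_le s : norm_of s <= m * (2 ^ m) ^ 2.
  have -> : m * (2 ^ m) ^ 2 = \sum_(i < m) (2 ^ m) ^ 2 by rewrite sum_nat_const card_ord.
  rewrite /norm_of; apply: leq_sum => i _.
  by rewrite leq_exp2r // ltnW // (leq_trans (ltn_ord _)).
pose PS : finType := ('rV['I_n]_d * {ffun 'I_m -> 'I_b})%type.
pose cls : finType := ('I_(n * W + n).+1 * 'I_(m * (2 ^ m) ^ 2).+1)%type.
have cls1 (ps : PS) : phi (grid_point ps.1) + n - val_of ps.2 < (n * W + n).+1.
  by rewrite ltnS (leq_trans (leq_subr _ _)) // leq_add2r.
pose f (ps : PS) : cls := (Ordinal (cls1 ps), Ordinal (norm_le ps.2 : _ < _.+1)).
have [c hc] : exists c : cls, #|{: PS}| <= #|[set ps | f ps == c]%SET| * #|cls|.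
  have c0 : cls by apply: (pair ord0 ord0).
  case: (arg_maxnP (fun c => #|[set ps | f ps == c]%SET|) (P := xpredT) (i0 := c0) isT) => c _ cmax.
  exists c; apply: (@leq_trans (\sum_(c' : cls) #|[set ps | f ps == c']%SET|)).
    rewrite -sum1_card (partition_big f xpredT) //=; apply: leq_sum => c' _.
    by rewrite -sum1_card; apply: eq_leq; apply: eq_bigl => ps; rewrite inE.
  apply: (@leq_trans (\sum_(c' : cls) #|[set ps | f ps == c]%SET|)).
    by apply: leq_sum => c' _; apply: cmax.
  by rewrite sum_nat_const mulnC.
pose A := [set p | [exists s, f (p, s) == c]]%SET.
(* Within a class the point determines the value of the digit vector, hence the vector itself, so
   projecting to the point is injective. *)
have fib : #|[set ps | f ps == c]%SET| <= #|A|.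
  rewrite -(card_in_imset (f := fun ps : PS => ps.1)).
    apply/subset_leq_card/fintype.subsetP => p /imsetP[[p' s]].
    by rewrite !inE /= => hf ->; apply/existsP; exists s.
  move=> [p s] [p' s']; rewrite !inE /= => /eqP E /eqP E' pp.
  rewrite -pp in E' *; congr (_, _).
  have := congr1 (fun c : cls => nat_of_ord c.1) E.
  have := congr1 (fun c : cls => nat_of_ord c.1) E'.
  rewrite /= => e1 e2.
  have vv : val_of s = val_of s' by have := val_lt s; have := val_lt s'; lia.
  apply/ffunP => i; apply: val_inj; move: i; apply: (digit_sum_inj _ _ vv) => i;
    exact: leq_trans bm.
have Afree : A \in free_sets R X n.
  apply/free_setsP => e; rewrite inE => /asboolP[b' [r [r0 hX _]]].
  apply/negP => /fintype.subsetP eA.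
  have getp u : u \in X -> exists (p : 'rV['I_n]_d) s,
      [/\ phi (grid_point p) + n = c.1 + val_of s, norm_of s = c.2 &
        ((phi (grid_point p))%:R = real_functional B b' + r * (phi u)%:R :> R)%R].
    move=> uX; have [p pe hp] := hX u uX.
    have := eA p pe; rewrite inE => /existsP[s /eqP E].
    exists p, s; split.
    - by rewrite -E /= subnK //; apply: leq_trans (ltnW (val_lt s)) (leq_addl _ _).
    - by rewrite -E.
    - by rewrite -!real_functional_vec -[real_vec R (grid_point p)]/(pt p) hp
        real_functionalD real_functionalZ.
  have [px [sx [px1 px2 px3]]] := getp x xX.
  have [py [sy [py1 py2 py3]]] := getp y yX.
  have [pz [sz [pz1 pz2 pz3]]] := getp z zX.
  have E : l1 * phi (grid_point px) + l2 * phi (grid_point py) =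
      (l1 + l2) * phi (grid_point pz).
    apply/eqP; rewrite -(eqr_nat R) natrD !natrM natrD px3 py3 pz3.
    rewrite /l1 /l2 !natrB ?(ltnW xz) ?(ltnW zy) //; apply/eqP; ring.
  have E' : l1 * val_of sx + l2 * val_of sy = (l1 + l2) * val_of sz.
    have := congr1 (fun i => i + (l1 + l2) * n) E; rewrite /=.
    have -> : l1 * phi (grid_point px) + l2 * phi (grid_point py) + (l1 + l2) * n =
      l1 * (phi (grid_point px) + n) + l2 * (phi (grid_point py) + n) by lia.
    have -> : (l1 + l2) * phi (grid_point pz) + (l1 + l2) * n =
      (l1 + l2) * (phi (grid_point pz) + n) by lia.
    by rewrite px1 py1 pz1; lia.
  have comb (s : {ffun 'I_m -> 'I_b}) l : l * val_of s = digit_sum (2 ^ m) (fun i => l * s i).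
    by rewrite /val_of /digit_sum big_distrr /=; apply: eq_bigr => i _; rewrite mulnA.
  have dig i : l1 * sx i + l2 * sy i = (l1 + l2) * sz i.
    move: i; apply: (@digit_sum_inj (2 ^ m)).
    - move=> i; apply: leq_trans hlb.
      have := ltn_ord (sx i); have := ltn_ord (sy i).
      by move: (nat_of_ord _) (nat_of_ord _) => u v; nia.
    - move=> i; apply: leq_trans hlb; rewrite ltn_pmul2l ?ltn_ord //; lia.
    rewrite -comb -E' !comb /digit_sum -big_split /=; apply: eq_bigr => i _.
    by rewrite mulnDl.
  have sxy : sx = sy.
    apply/ffunP => i; apply: val_inj; move: i.
    exact: (sphere_strictly_convex l10 l20 dig px2 py2 pz2).
  have : phi (grid_point px) = phi (grid_point py).
    by apply: (@addIn n); rewrite px1 py1 sxy.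
  move=> /(congr1 (fun i => i%:R : R)%R); rewrite px3 py3 => /addrI.
  move/mulfI => /(_ (lt0r_neq0 r0))/eqP; rewrite eqr_nat => /eqP.
  by move=> hxy; move: (ltn_trans xz zy); rewrite hxy ltnn.
have hA := max_free_ge Afree.
have cPS : #|{: PS}| = n ^ d * b ^ m.
  by rewrite card_prod card_mx mul1n card_ord card_ffun !card_ord.
have ccls : #|cls| <= n * 2 ^ m * 2 ^ (3 * m).
  rewrite card_prod !card_ord leq_mul //.
    have : W + 2 <= 2 ^ m by apply: leq_trans (ltnW (ltn_expl m (isT : 1 < 2))); lia.
    by nia.
  rewrite (_ : 3 * m = m + m * 2); last by lia.
  rewrite expnD expnM; have := ltn_expl m (isT : 1 < 2).
  have : 0 < (2 ^ m) ^ 2 by rewrite !expn_gt0.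
  by nia.
have bE : b ^ m * 2 ^ (h * m) = n.
  by rewrite /b -expnM -expnD /n; congr (2 ^ _); nia.
have main : n ^ d * b ^ m <= max_free R X n * (n * 2 ^ m * 2 ^ (3 * m)).
  rewrite -cPS; apply: leq_trans hc _; apply: leq_mul ccls; exact: leq_trans fib hA.
rewrite -(leq_pmul2r n0) -{2}bE.
have -> : 2 ^ ((h + 4) * m) = 2 ^ (h * m) * 2 ^ m * 2 ^ (3 * m).
  by rewrite -!expnD; congr (2 ^ _); lia.
have := leq_mul main (leqnn (2 ^ (h * m))).
rewrite -bE; lia.
Qed.
End Behrend.

Lemma max_free_le n : (max_free R X n <= n ^ d)%N.
Proof.
apply/bigmax_leqP => A _; apply: leq_trans (max_card _) _.
by rewrite card_mx card_ord mul1n.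
Qed.

End Copies.

Section RegularScales.
Local Open Scope nat_scope.

(* If the density [r m / N m] dropped by the factor [2 ^ (C * a + 1)] at each
   step [m -> m + a], it would eventually fall below its lower bound
   [2 ^ - (C * m)]. *)
Lemma regular_scales (r N : nat -> nat) (C m0 a : nat) :
  (forall m, (0 < N m)%N) -> (forall m, (r m <= N m)%N) ->
  (forall m, (m0 <= m)%N -> (N m <= r m * 2 ^ (C * m))%N) ->
  forall m1, exists2 m, (m1 <= m)%N &
    (r m * N (m + a) <= 2 ^ (C * a + 1) * r (m + a) * N m)%N.
Proof.
move=> N0 rN hr m1; apply: contrapT => hno.
set L := C * a + 1; pose m2 := m0 + m1.
have drop m : m1 <= m -> 2 ^ L * r (m + a) * N m <= r m * N (m + a).
  by move=> hm; rewrite leqNgt; apply/negP => h; apply: hno; exists m => //; apply: ltnW.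
have main i : 2 ^ (L * i) * r (m2 + i * a) * N m2 <= r m2 * N (m2 + i * a).
  elim: i => [|i IH]; first by rewrite muln0 mul1n mul0n addn0.
  have := drop (m2 + i * a); rewrite -addnA -mulSnr => /(_ _)-h.
  have {}h := h (leq_trans (leq_addl _ _) (leq_addr _ _)).
  rewrite -(leq_pmul2r (N0 (m2 + i * a))) mulnS expnD.
  have := leq_mul (leqnn (2 ^ (L * i) * N m2)) h.
  have := leq_mul IH (leqnn (N (m2 + i.+1 * a))).
  lia.
(* With [L = C * a + 1] this makes [L * i] exceed [C * (m2 + i * a)]. *)
pose i := (C * m2).+1.
have := main i; have := rN m2; have := hr (m2 + i * a).
have -> : m0 <= m2 + i * a by rewrite /m2 -!addnA leq_addr.
move=> /(_ isT) h1 h2 h3; have h4 := N0 m2; have h5 := N0 (m2 + i * a).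
have r0 : 0 < r (m2 + i * a) by move: h1; case: (r _) => //; lia.
have : 2 ^ (L * i) * r (m2 + i * a) * N m2 <= N m2 * N (m2 + i * a).
  by apply: leq_trans h3 _; rewrite leq_mul2r h2 orbT.
rewrite [N m2 * _]mulnC leq_pmul2r // => /leq_trans/(_ h1).
rewrite mulnC leq_pmul2l // leq_exp2l // leqNgt => /negP; apply.
by rewrite /L /i; nia.
Qed.
End RegularScales.

(** * Choice of parameters and the count at good scales *)

Section Counting.
Local Open Scope nat_scope.

Lemma sqrnD_sub a b : (b + a) * (b + a) = b * b + (2 * a * (b + a) - a * a).
Proof. by rewrite !mulnDr !mulnDl; lia. Qed.

Lemma free_sets_count (R : realType) (d : nat) (hd : (0 < d)%N)
    (X : {fset 'rV[nat]_d}) (hX : (3 <= #|` X|)%N) :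
  exists C : nat, forall m1, exists2 m, (m1 <= m)%N &
    (#|free_sets R X (2 ^ (m * m))| <= 2 ^ (C * max_free R X (2 ^ (m * m))))%N.
Proof.
have [C0 [m0 hC0]] := behrend_bound R hX.
set k := #|` X| in hX *.
(* [C0] is the initial density loss as a power of [y], and [w] lies beyond its [k]-fold iterate. The
   surplus [C0 + 4] in [q] leaves a spare [y ^ 4] between the number of [yes] answers and the
   largest free sets; the surplus 4 in [a] lets the primes outweigh the factor
   [4 * a * m * m * m]. *)
pose w := (iter k (fun p => 2 * p + 3) C0).+1.
pose q := w + C0 + 4.
pose delta := k * q.
pose a := delta + 4.
pose r m := max_free R X (2 ^ (m * m)).
pose N m := (2 ^ (m * m)) ^ d.
pose L := C0 * a + 1.
(* [2 ^ (d + 1)] pays for the box positions in supersaturation, [2 ^ L] for the density drop between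
   the two scales and [k] for the loss in balancing. In the final exponent [2 * K] bounds the
   containers, and the 1 absorbs the [yes] answers. *)
pose K := 2 ^ (d + 1 + L) * k.
exists (2 * K + 1) => m1.
pose m2 := m0 + m1 + a + q + 6 * k + k * k + d * k + 4 * a + 6.
have : [/\ m0 <= m2, m1 <= m2, a <= m2, q <= m2 &
    [/\ 6 * k <= m2, k * k <= m2, d * k <= m2, 4 * a <= m2 & 6 <= m2]].
  by rewrite /m2; split; last split; lia.
move: m2 => m2 [m0m2 m1m2 am2 qm2 [k6m2 kkm2 dkm2 a4m2 m2_6]].
have [||m' hm' hreg] := @regular_scales r N C0 m0 a _ _ hC0 m2.
- by move=> m; rewrite !expn_gt0.
- by move=> m; apply: max_free_le.
set m := m' + a in hreg.
have mm2 : m2 <= m by rewrite (leq_trans hm') ?leq_addr.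
exists m; first exact: leq_trans mm2.
rewrite -/L in hreg.
set n := 2 ^ (m * m); set M := 2 ^ (m' * m'); set y := 2 ^ m.
have my : m < y by apply: ltn_expl.
have m2y : m2 <= y by apply: leq_trans mm2 (ltnW my).
have y0 : 0 < y by rewrite expn_gt0.
have n0 : 0 < n by rewrite expn_gt0.
have M0 : 0 < M by rewrite expn_gt0.
have yE i : y ^ i = 2 ^ (m * i) by rewrite -expnM.
have rn : n ^ d <= max_free R X n * y ^ C0.
  by rewrite yE [m * C0]mulnC; apply/hC0/leq_trans/mm2.
set rr := max_free R X n in rn *.
pose T := 2 * a * m - a * a.
have nMT : n = M * 2 ^ T.
  rewrite /n /M -expnD; congr (2 ^ _); exact: sqrnD_sub.
have Xk : 0 < k by apply: leq_trans hX.
have copies_many (A : {set 'rV['I_n]_d}) : K * rr <= #|A| ->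
    y ^ delta * #|A| <= #|copies_in R X A|.
  move=> hA.
  (* In fact [T = a * m + a * m'], since [m = m' + a]. *)
  have T1 : a * m < T.
    have a0 : 0 < a by rewrite /a addn_gt0 orbT.
    have m'0 : 0 < m' by apply: leq_trans hm'; apply: leq_trans m2_6.
    have am' : 0 < a * m' by rewrite muln_gt0 a0.
    by rewrite /T /m; move: (a) (m') am' => i j; rewrite !mulnDr; lia.
  pose u := 2 ^ T.-1.
  have uu : u + u = 2 ^ T by rewrite addnn -mul2n -expnS prednK //; lia.
  have u0 : 0 < u by rewrite expn_gt0.
  have hQ := leq_exp2_primes_upto u0.
  rewrite uu -expnM leq_exp2l // in hQ.
  have hsup : size (primes_upto (2 ^ T)) * #|A| <= 2 * (m * m * #|copies_in R X A|).
    apply: (@supersaturation _ _ _ n M) => //.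
    - by lia.
    - by rewrite filter_uniq // iota_uniq.
    - move=> p; rewrite mem_filter mem_iota => /and3P[-> _ hp]; split=> //.
      by rewrite nMT mulnC leq_mul2l orbC -ltnS -add1n hp.
    apply: (@leq_trans (K * rr * M ^ d)); last by rewrite leq_mul2r hA orbT.
    have nn : (n + n) ^ d = 2 ^ d * n ^ d by rewrite addnn -mul2n expnMn.
    rewrite nn /K expnD [2 ^ (d + 1)]expnD expn1.
    have := leq_mul (leqnn (2 ^ d * 2)) hreg; rewrite -/n -/M /r /N -/n -/M -/rr => h.
    apply: leq_trans (_ : 2 ^ d * 2 * (2 ^ L * rr * M ^ d) <= _).
      by apply: leq_trans h; rewrite leq_eqVlt; apply/orP; left; apply/eqP; lia.
    rewrite (_ : 2 ^ d * 2 * 2 ^ L * k * rr * M ^ d = 2 ^ d * 2 * (2 ^ L * rr * M ^ d) * k); last by lia.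
    by rewrite leq_pmulr.
  have Tm : T <= 2 * a * m by rewrite leq_subr.
  have u1 : u * #|A| <= 4 * a * m * m * m * #|copies_in R X A|.
    apply: (@leq_trans (T * size (primes_upto (2 ^ T)) * #|A|)); first by rewrite leq_mul2r hQ orbT.
    rewrite -mulnA; apply: leq_trans (leq_mul Tm hsup) _.
    by rewrite leq_eqVlt; apply/orP; left; apply/eqP; lia.
  have u2 : 4 * a * m * m * m * y ^ delta <= u.
    apply: (@leq_trans (y ^ a)); last first.
      by rewrite yE /u leq_exp2l // mulnC; lia.
    have -> : y ^ a = y * y * y * y * y ^ delta.
      by rewrite /a addnC expnD !expnS expn0 muln1 !mulnA.
    have a4 : 4 * a <= y by apply: leq_trans a4m2 m2y.
    by rewrite !leq_mul // ltnW.
  have c0 : 0 < 4 * a * m * m * m.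
    have : 0 < a by rewrite /a addn_gt0 orbT.
    have : 0 < m by apply: leq_trans mm2; apply: leq_trans m2_6.
    by rewrite !muln_gt0 => -> ->.
  rewrite -(leq_pmul2l c0); apply: leq_trans u1.
  by rewrite mulnA leq_mul2r u2 orbT.
have md : m <= m * d by rewrite leq_pmulr.
have qm : q <= m by apply: leq_trans mm2.
have nd : n ^ d = 2 ^ (m * (m * d)) by rewrite /n -expnM mulnA.
(* All sizes being powers of two, [s] and [rho] are exactly [n ^ d / y ^ q] and [n ^ d / y ^ w]. *)
pose s := 2 ^ (m * (m * d - q)); pose rho := 2 ^ (m * (m * d - w)).
have wq : w <= q by rewrite /q -addnA leq_addr.
have Vcard : #|{: 'rV['I_n]_d}| = n ^ d by rewrite card_mx card_ord mul1n.
have Vs : #|{: 'rV['I_n]_d}| = s * y ^ q.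
  by rewrite Vcard nd yE -expnD -mulnDr subnK // (leq_trans qm).
have Vrho : #|{: 'rV['I_n]_d}| = rho * y ^ w.
  by rewrite Vcard nd yE -expnD -mulnDr subnK // (leq_trans wq) // (leq_trans qm).
have C0w : C0 <= w.
  by rewrite /w ltnW // ltnS leq_iter_affine.
have K0 : k <= K by rewrite leq_pmull // expn_gt0.
have rhoc : rho <= 2 * (K * rr).
  have : rho * y ^ w <= rr * y ^ w.
    rewrite -Vrho Vcard; apply: leq_trans rn _.
    by rewrite leq_mul2l leq_pexp2l // orbT.
  rewrite leq_pmul2r ?expn_gt0 ?y0 // => /leq_trans; apply.
  by rewrite mulnA leq_pmull // muln_gt0 /= (leq_trans Xk).
(* The container size is [2 * (K * rr)] because balancing asks for twice the size at which
   supersaturation sets in. *)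
have big := @container_count _ (fun A => A \in free_sets R X n) s rho k (k * k)
  y q w C0 delta (2 * (K * rr)).
have -> : #|free_sets R X n| = #|[set A | A \in free_sets R X n]%SET|.
  by apply: eq_card => A; rewrite inE.
apply: leq_trans (big _ _ _ _ _ _ _ _ _ _ _ _) _ => //.
- exact: leq_trans m2y.
- exact: leq_trans m2y.
- exact: leq_ltn_trans (leq_trans kkm2 mm2) my.
- by rewrite expn_gt0.
- by rewrite expn_gt0.
- move=> A hA.
  have [||F [FG Fdeg Fcard]] := @balanced_subhypergraph _ (copies R X n) A k
    (y ^ delta) (K * rr) Xk _ _ hA.
  + exact: card_copy_le.
  + move=> A' _ hA'; apply: leq_trans (copies_many A' hA').
    by rewrite leq_mul2l hA' orbT.
  have Fc e : e \in F -> e \in copies R X n /\ e \subset A.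
    by move=> /(fintype.subsetP FG); rewrite inE => /andP[].
  exists F; split=> //.
  + by move=> e I /Fc[ec _] /free_setsP; apply.
  + by move=> e /Fc[ec eA]; split=> //; apply: card_copy_le ec.
  + move=> u v uv; apply: leq_trans (codegree_copies R X uv).
    apply/subset_leq_card/fintype.subsetP => e.
    by rewrite inE => /andP[/Fc[ec _] huv]; rewrite inE ec.
  rewrite Vcard; apply: leq_trans (leq_mul rn (leqnn (y ^ delta))) _.
  rewrite mulnAC leq_mul2r; apply/orP; right.
  rewrite -(leq_pmul2l Xk); apply: leq_trans Fcard.
  have := leq_mul K0 (leqnn (rr * y ^ delta)); lia.
rewrite Vcard.
set S := k * s * y ^ w.
(* A [yes] answer costs about [m * (m * d)] bits, the logarithm of the grid size; the spare factor
   [y ^ 4] exceeds this cost times [k]. *)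
have hS : (m * (m * d) + 2) * S <= rr.
  have h1 : s * y ^ w * y ^ 4 <= rr.
    rewrite -(leq_pmul2r (_ : 0 < y ^ C0)) ?expn_gt0 ?y0 //.
    apply: leq_trans rn; rewrite -Vcard Vs /q !expnD.
    by rewrite leq_eqVlt; apply/orP; left; apply/eqP; lia.
  apply: leq_trans h1; rewrite /S.
  rewrite (_ : _ * (k * s * y ^ w) = s * y ^ w * ((m * (m * d) + 2) * k)); last by lia.
  rewrite leq_mul2l; apply/orP; right.
  have dk : d * k <= y by apply: leq_trans m2y.
  have m6 : 6 <= m by apply: leq_trans mm2.
  rewrite (_ : y ^ 4 = y * y * y * y); last by rewrite !expnS expn0 muln1 !mulnA.
  apply: (@leq_trans (3 * m * m * (d * k))).
    have mmd : 0 < m * m * d by rewrite !muln_gt0 hd (leq_trans _ m6).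
    rewrite (_ : 3 * m * m * (d * k) = (m * (m * d) + 2 * (m * m * d)) * k); last by lia.
    by rewrite leq_mul2r leq_add2l leq_pmulr ?orbT.
  have y3 : 3 <= y by apply: leq_trans (ltnW my); apply: leq_trans m6.
  by rewrite !leq_mul // ltnW.
apply: (@leq_trans (2 ^ ((m * (m * d)).+1 * S) * 2 ^ (2 * (K * rr) + S))).
  rewrite leq_mul2r; apply/orP; right.
  have hn : (n ^ d).+1 <= 2 ^ (m * (m * d)).+1.
    by rewrite nd expnS mul2n -addnn -addn1 leq_add2l expn_gt0.
  by rewrite expnM; case: (S) => // S'; rewrite leq_exp2r.
rewrite -expnD leq_exp2l //.
rewrite (_ : (m * (m * d)).+1 * S + _ = (m * (m * d) + 2) * S + 2 * (K * rr)); last by lia.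
by rewrite [leqRHS]mulnDl mul1n [leqRHS]addnC -[2 * K * rr]mulnA leq_add2r.
Qed.
End Counting.

Theorem theorem1p4 (R : realType) (d : nat) (hd : (0 < d)%N)
    (X : {fset 'rV[nat]_d}) (hX : (3 <= #|` X|)%N) :
  exists C : R, 0 < C /\
    exists N : set nat, infinite_set N /\
      forall n : nat, N n ->
        (#|free_sets R X n|)%:R <= 2 `^ (C * (max_free R X n)%:R).
Proof.
have [C hC] := free_sets_count R hd hX.
exists C.+1%:R; split; first by rewrite ltr0n.
(* All [n] that satisfy the bound are taken. Were they finitely many, a good [2 ^ (m * m)] with [m]
   beyond their maximum would be a contradiction. *)
exists (fun n => (#|free_sets R X n| <= 2 ^ (C * max_free R X n))%N); split.
  move=> /finite_seqP[s hs].
  have [m hm hn] := hC (\max_(i <- s) i).+1.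
  move/seteqP: hs => [/(_ _ hn)/= hs _].
  have hle := @leq_bigmax_seq _ s xpredT id _ hs isT.
  have mlt : (m < 2 ^ (m * m))%N.
    apply: leq_trans (ltn_expl m (isT : 1 < 2)%N) _.
    by rewrite leq_exp2l // leq_pmulr // (leq_trans _ hm).
  by have := leq_trans hm (leq_trans (ltnW mlt) hle); rewrite ltnn.
move=> n hn; rewrite -natrM powR_mulrn ?ler0n // -natrX ler_nat.
by apply: leq_trans hn _; rewrite leq_exp2l // leq_mul2r leqnSn orbT.
Qed.
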